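(* Let $Q$ be a network with root $O$ (satisfying the standing assumption in the context), let $\rho=\rho(Q)$ be its randomized expanding competitive ratio, and let $s$ be the (expanding) randomized doubling strategy on $Q$ defined in the context. Then $s$ is a $5/4$-approximation of the optimal randomized search. In particular, $$\rho_s(Q)\le \tfrac54\,\rho(Q)+\tfrac12 .$$
   Context: A network $Q$ is a connected metric graph made of vertices and arcs (possibly unbounded), with a distinguished root vertex $O$, endowed with Lebesgue (length) measure $\lambda$; $\mu=\lambda(Q)\in(0,\infty]$ is its total measure. $d(x)$ is the length of a shortest path from $O$ to $x$. Standing assumption: there is an integer $M$ such that $|\{x\in Q: d(x)=r\}|\le M$ for all $r>0$. An expanding search is a family of connected subsets $S(t)\subset Q$, $0\le t\le\mu$ ($t<\infty$), with $S(0)=\{O\}$, $S(t)\subset S(t')$ for $t\le t'$, and $\lambda(S(t))=t$ for all $t$. The search time of $H\in Q$ is $T(S,H)=\min\{t: H\in S(t)\}$; the normalized search time is $\hat T(S,H)=T(S,H)/d(H)$ for $H\ne O$, and $\hat T(S,O)=0$. A randomized search $s$ is a probability distribution over expanding searches; $\hat T(s,H)$ is the expected normalized search time; $\rho_s(Q)=\sup_{H\in Q}\hat T(s,H)$ and $\rho(Q)=\inf_s\rho_s(Q)$. A randomized search $s$ is an $\alpha$-approximation of the optimal randomized search if its competitive ratio $\rho_s(Q)$ is within a factor at most $\alpha$ of the optimal randomized competitive ratio $\rho(Q)$, i.e. $\rho_s(Q)\le\alpha\,\rho(Q)$. Shortest path tree: $Q_T$ is the shortest path tree of $Q$ rooted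 at $O$, i.e. the (metric) tree obtained from $Q$ by cutting it at points reached by more than one shortest path from $O$, so that every point $x$ of $Q_T$ is joined to $O$ by a unique path, of length $d(x)$. A search of $Q_T$ naturally translates to a search of $Q$. Randomized Depth-First Search (RDFS): for a rooted tree $\mathcal T$, let $S$ be any depth-first (expanding) search of $\mathcal T$ and let $S^{-1}$ be the depth-first search visiting the leaf nodes of $\mathcal T$ in the reverse order from $S$. An RDFS chooses $S$ or $S^{-1}$ with probability $1/2$ each. Randomized doubling strategy: for each $j\in\mathbb Z$ choose $d_j$ uniformly at random from $[2^{j-1},2^j]$, and set $R_j=\{x\in Q_T: d_j\le d(x)<d_{j+1}\}$. The sets $R_j$ are searched in increasing order of $j\in\mathbb Z$ (thus starting with infinitely many infinitesimally small searches): at the start of iteration $j$, $\bigcup_{i<j}R_i$ has already been searched and is shrunk to the root, so that $R_j$ becomes a subtree of the resulting network, and iteration $j$ is an RDFS of $R_j$.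
   Formalization: The clause that s is a 5/4-approximation, read as ρ_s ≤ (5/4)ρ, is false (half-line with a short twig at distance √2: ρ is near 1, ρ_s at least about 1.293) and is dropped; only the displayed inequality ρ_s ≤ (5/4)ρ + 1/2 is stated and proved. *)

(* Defs.v *)
From HB Require Import structures.
From mathcomp Require Import all_boot all_order all_algebra.
From mathcomp Require Import all_classical all_reals all_analysis.
From mathcomp Require Import measurable_realfun.

Set Implicit Arguments.
Unset Strict Implicit.
Unset Printing Implicit Defensive.

Import Order.TTheory GRing.Theory Num.Theory.
Import numFieldNormedType.Exports.

Local Open Scope classical_set_scope.
Local Open Scope ring_scope.

(* An arc of length +oo is a ray issuing from [src e]; its [tgt e] is not
   attached to anything and is ignored everywhere below.  Loops, parallel arcs
   and infinitely many vertices are allowed. *)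
Record metric_graph (R : realType) := MetricGraph {
  vertex : choiceType ;
  garc : choiceType ;
  src : garc -> vertex ;
  tgt : garc -> vertex ;
  len : garc -> \bar R ;
  len_gt0 : forall e, (0 < len e)%E ;
  rootv : vertex }.

(* [inl v] is a vertex; [inr (e, t)] is the interior point of [e] at
   distance [t] from [src e] along [e], 0 < t < len e. *)
Definition gpoint (R : realType) (Q : metric_graph R) : Type :=
  (vertex Q + {p : garc Q * R | (0 < p.2) && (p.2%:E < len p.1)%E})%type.

HB.instance Definition _ (R : realType) (Q : metric_graph R) :=
  Choice.on (gpoint Q).

Definition origin (R : realType) (Q : metric_graph R) : gpoint Q := inl (rootv Q).

(* [x] is the point of the closed arc [e] at distance [t] from [src e] along
   [e]; on a loop the vertex is at both [0] and [len e]. *)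
Definition on_arc (R : realType) (Q : metric_graph R)
    (e : garc Q) (t : R) (x : gpoint Q) : Prop :=
  match x with
  | inl v => (t = 0 /\ v = src e) \/ (t%:E = len e /\ v = tgt e)
  | inr p => val p = (e, t)
  end.

(* [joined x y l]: some path from [x] to [y], made of finitely many pieces of
   arcs, has length [l]. *)
Inductive joined (R : realType) (Q : metric_graph R) (x : gpoint Q) :
    gpoint Q -> R -> Prop :=
| joined_refl : joined x x 0
| joined_step (y z : gpoint Q) (l : R) (e : garc Q) (s t : R) :
    joined x y l -> on_arc e s y -> on_arc e t z ->
    joined x z (l + `|t - s|).

Definition gdist (R : realType) (Q : metric_graph R) (x y : gpoint Q) : R :=
  inf [set l | joined x y l].

Definition depth (R : realType) (Q : metric_graph R) (x : gpoint Q) : R :=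
  gdist (origin Q) x.

Section PointTopology.
Variables (R : realType) (Q : metric_graph R).

Definition point_open : set_system (gpoint Q) :=
  [set U | forall x, U x ->
     exists2 e : R, 0 < e & forall y, gdist x y < e -> U y].

Lemma point_openT : point_open setT.
Proof. by move=> x _; exists 1. Qed.

Lemma point_openI : setI_closed point_open.
Proof.
move=> U V oU oV x [/oU [e1 e1_gt0 eU] /oV [e2 e2_gt0 eV]].
exists (Num.min e1 e2); first by rewrite lt_min e1_gt0.
by move=> y; rewrite lt_min => /andP[? ?]; split; [exact: eU|exact: eV].
Qed.

Lemma point_open_bigU (I : Type) (f : I -> set (gpoint Q)) :
  (forall i, point_open (f i)) -> point_open (\bigcup_i f i).
Proof.
move=> of_ x [i _ /of_ [e e_gt0 ef]]; exists e => // y /ef fy.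
by exists i.
Qed.

HB.instance Definition _ := isOpenTopological.Build (gpoint Q)
  point_openT point_openI point_open_bigU.

End PointTopology.

(* Vertices contribute nothing, so including the end points of the arcs here
   is harmless. *)
Definition lambda (R : realType) (Q : metric_graph R) (A : set (gpoint Q)) :
    \bar R :=
  \esum_(e in [set: garc Q])
    lebesgue_measure ([set t : R | exists2 x, A x & on_arc e t x] : set R).

Definition total_length (R : realType) (Q : metric_graph R) : \bar R :=
  lambda [set: gpoint Q].

Definition connected_graph (R : realType) (Q : metric_graph R) : Prop :=
  forall x : gpoint Q, exists l, joined (origin Q) x l.

Definition finite_spheres (R : realType) (Q : metric_graph R) : Prop :=
  exists M : nat, forall r : R, 0 < r ->
    ([set x : gpoint Q | depth x = r] #<= `I_M)%card.

Definition network (R : realType) (Q : metric_graph R) : Prop :=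
  [/\ connected_graph Q, (0 < total_length Q)%E & finite_spheres Q].

(* Only the values of [S] on [{t | 0 <= t <= total_length Q}] are constrained. *)
Definition expanding_search (R : realType) (Q : metric_graph R)
    (S : R -> set (gpoint Q)) : Prop :=
  [/\ S 0 = [set origin Q],
      forall t t' : R, 0 <= t -> t <= t' -> (t'%:E <= total_length Q)%E -> S t `<=` S t',
      forall t : R, 0 <= t -> (t%:E <= total_length Q)%E -> connected (S t) &
      forall t : R, 0 <= t -> (t%:E <= total_length Q)%E -> lambda (S t) = t%:E].

(* An infimum in \bar R: it is the minimum when the latter exists, and +oo when
   [H] is never found. *)
Definition search_time (R : realType) (Q : metric_graph R)
    (S : R -> set (gpoint Q)) (H : gpoint Q) : \bar R :=
  ereal_inf [set t%:E | t in [set t : R | [/\ 0 <= t, (t%:E <= total_length Q)%E & S t H]]].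

Definition norm_search_time (R : realType) (Q : metric_graph R)
    (S : R -> set (gpoint Q)) (H : gpoint Q) : \bar R :=
  if H == origin Q then 0%E else (search_time S H * (depth H)^-1%:E)%E.

(* A probability distribution over expanding searches is given as a random
   element [S] on a probability space; the measurability condition is what
   makes every expected normalized search time meaningful. *)
Definition randomized_search (R : realType) (Q : metric_graph R)
    (d : measure_display) (Omega : measurableType d) (P : probability Omega R)
    (S : Omega -> R -> set (gpoint Q)) : Prop :=
  (forall w, expanding_search (S w)) /\
  (forall H, measurable_fun setT (fun w => norm_search_time (S w) H)).

Definition exp_norm_search_time (R : realType) (Q : metric_graph R)
    (d : measure_display) (Omega : measurableType d) (P : probability Omega R)
    (S : Omega -> R -> set (gpoint Q)) (H : gpoint Q) : \bar R :=
  (\int[P]_w norm_search_time (S w) H)%E.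

Definition rho_of (R : realType) (Q : metric_graph R)
    (d : measure_display) (Omega : measurableType d) (P : probability Omega R)
    (S : Omega -> R -> set (gpoint Q)) : \bar R :=
  ereal_sup (range (exp_norm_search_time P S)).

Definition rho (R : realType) (Q : metric_graph R) : \bar R :=
  ereal_inf [set r | exists (d : measure_display) (Omega : measurableType d)
    (P : probability Omega R) (S : Omega -> R -> set (gpoint Q)),
    randomized_search P S /\ r = rho_of P S].

(* An arc with a direction of travel; [true] is from [src] to [tgt]. *)
Fixpoint is_walk (R : realType) (Q : metric_graph R)
    (u : vertex Q) (w : seq (garc Q * bool)) (v : vertex Q) : Prop :=
  match w with
  | [::] => u = v
  | (e, b) :: w' =>
      [/\ (len e < +oo)%E, u = (if b then src e else tgt e) &
          is_walk (if b then tgt e else src e) w' v]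
  end.

Definition reduced (R : realType) (Q : metric_graph R) :=
  sorted (fun a b : garc Q * bool => b != (a.1, ~~ a.2)).

(* Every vertex, hence every point, is joined to the root by a unique path. *)
Definition metric_tree (R : realType) (T : metric_graph R) : Prop :=
  connected_graph T /\
  forall (v : vertex T) w w',
    is_walk (rootv T) w v -> reduced w ->
    is_walk (rootv T) w' v -> reduced w' -> w = w'.

(* [T] is obtained from [Q] by cutting; [proj] glues the cut points back.
   Every arc of [T] is, isometrically, a piece of an arc of [Q], and only
   vertices of [T] are glued together, so nothing but cut points is
   duplicated.  Distinct points of [T] with the same image [x] are joined to
   the root by distinct paths of length [depth x], whose images are distinct
   shortest paths to [x] in [Q]: cuts occur only at points reached by more than
   one shortest path. *)
Record shortest_path_tree (R : realType) (Q T : metric_graph R)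
    (proj : gpoint T -> gpoint Q) : Prop := ShortestPathTree {
  spt_tree : metric_tree T ;
  spt_root : proj (origin T) = origin Q ;
  spt_surj : forall x, exists y, proj y = x ;
  spt_arc : forall e : garc T, exists (e' : garc Q) (a : R) (b : bool),
    forall t y, on_arc e t y -> on_arc e' (a + (-1) ^+ b * t) (proj y) ;
  spt_glue : forall y z, proj y = proj z -> y = z \/
    exists v v' : vertex T, y = inl v /\ z = inl v' ;
  spt_depth : forall y, depth y = depth (proj y) }.

(* In a tree: [x] lies on the path from the root to [y]. *)
Definition ancestor (R : realType) (T : metric_graph R) (x y : gpoint T) : Prop :=
  depth y = depth x + gdist x y.

(* The order in which a depth-first search of [W] visits its points: a strict
   total order in which ancestors come first and in which the descendants of
   any point are visited consecutively.  [W] is a union of subtrees of [T]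
   attached to a common root, points of different subtrees being
   incomparable for [ancestor]. *)
Record dfs_order (R : realType) (T : metric_graph R) (W : set (gpoint T))
    (L : gpoint T -> gpoint T -> Prop) : Prop := DfsOrder {
  dfs_irr : forall x, W x -> ~ L x x ;
  dfs_trans : forall x y z, W x -> W y -> W z -> L x y -> L y z -> L x z ;
  dfs_total : forall x y, W x -> W y -> x <> y -> L x y \/ L y x ;
  dfs_ancestor : forall x y, W x -> W y -> ancestor x y -> x <> y -> L x y ;
  dfs_subtree : forall x y z, W x -> W y -> W z ->
    ancestor x y -> L x z -> L z y -> ancestor x z }.

(* The depth-first order in which branches, hence leaf nodes, are visited in
   the reverse order. *)
Definition dfs_rev (R : realType) (T : metric_graph R)
    (L : gpoint T -> gpoint T -> Prop) (x y : gpoint T) : Prop :=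
  (ancestor x y /\ x <> y) \/ [/\ ~ ancestor x y, ~ ancestor y x & L y x].

(* Length searched, within [W], when [y] is reached. *)
Definition visit_time (R : realType) (T : metric_graph R) (W : set (gpoint T))
    (L : gpoint T -> gpoint T -> Prop) (y : gpoint T) : \bar R :=
  lambda [set z | W z /\ L z y].

Definition stratum (R : realType) (T : metric_graph R) (a b : R) :
    set (gpoint T) :=
  [set y | a <= depth y < b].

(* [L a b] is the depth-first search chosen for the stratum [a <= depth < b].
   As in any randomized strategy whose expected search times make sense, the
   choice has to depend measurably on the random thresholds. *)
Definition dfs_rule (R : realType) (T : metric_graph R)
    (L : R -> R -> gpoint T -> gpoint T -> Prop) : Prop :=
  (forall a b : R, 0 < a -> a < b -> dfs_order (stratum a b) (L a b)) /\
  (forall y : gpoint T, measurable_fun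
    [set ab : R * R | 0 < ab.1 /\ stratum ab.1 ab.2 y]
    (fun ab => visit_time (stratum ab.1 ab.2) (L ab.1 ab.2) y)).

(* The doubling search of [Q], translated from [T], for thresholds [X] and
   coin tosses [c]: by time [t] it has found the points reached by time [t]
   in the iteration [j] of their stratum, which starts when all points at
   depth less than [X j] have been searched. *)
Definition doubling_search (R : realType) (Q T : metric_graph R)
    (proj : gpoint T -> gpoint Q) (L : R -> R -> gpoint T -> gpoint T -> Prop)
    (X : int -> R) (c : int -> bool) (t : R) : set (gpoint Q) :=
  [set x | x = origin Q \/ exists (j : int) (y : gpoint T),
     let W := stratum (X j) (X (j + 1)) in
     let Lj := L (X j) (X (j + 1)) in
     [/\ proj y = x, W y &
         (lambda [set z : gpoint T | (depth z < X j)%R] +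
          visit_time W (if c j then Lj else dfs_rev Lj) y <= t%:E)%E]].

Definition mutually_independent (R : realType) (d : measure_display)
    (Omega : measurableType d) (P : probability Omega R) (I : choiceType)
    (F : I -> set (set Omega)) : Prop :=
  forall (s : seq I) (A : I -> set Omega), uniq s ->
    (forall i, i \in s -> F i (A i)) ->
    P (\bigcap_(i in [set` s]) A i) = (\prod_(i <- s) P (A i))%E.

Lemma pow2_lt (R : realType) (j : int) : (2 : R) ^ (j - 1) < 2 ^ j.
Proof. by rewrite ltr_eXz2l ?ltr1n// ltrBlDr ltrDl. Qed.

(* The thresholds [X j] and the coins [c j] are all mutually independent. *)
Record doubling_draws (R : realType) (d : measure_display)
    (Omega : measurableType d) (P : probability Omega R)
    (X : int -> Omega -> R) (c : int -> Omega -> bool) : Prop := DoublingDraws {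
  draw_measurable : forall j, measurable_fun setT (X j) ;
  coin_measurable : forall j, measurable_fun setT (c j) ;
  draw_range : forall (j : int) w, 2 ^ (j - 1) <= X j w <= 2 ^ j ;
  draw_uniform : forall j (A : set R), measurable A ->
    P (X j @^-1` A) = uniform_prob (pow2_lt R j) A ;
  coin_fair : forall j, P [set w | c j w] = (2^-1)%:E ;
  draw_indep : mutually_independent P (fun i : int + int =>
    match i with
    | inl j => [set X j @^-1` A | A in [set A : set R | measurable A]]
    | inr j => [set c j @^-1` B | B in [set: set bool]]
    end) }.

Definition randomized_doubling (R : realType) (Q : metric_graph R)
    (d : measure_display) (Omega : measurableType d) (P : probability Omega R)
    (S : Omega -> R -> set (gpoint Q)) : Prop :=
  exists (T : metric_graph R) (proj : gpoint T -> gpoint Q)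
    (L : R -> R -> gpoint T -> gpoint T -> Prop)
    (X : int -> Omega -> R) (c : int -> Omega -> bool),
    [/\ shortest_path_tree proj, dfs_rule L, doubling_draws P X c &
        forall w t, S w t = doubling_search proj L (X ^~ w) (c ^~ w) t].

(* Main.v *)
Require Import Defs.
From HB Require Import structures.
From mathcomp Require Import all_boot all_order all_algebra.
From mathcomp Require Import all_classical all_reals all_analysis.
From mathcomp Require Import measurable_realfun.
From mathcomp Require Import ring lra.

Set Implicit Arguments.
Unset Strict Implicit.
Unset Printing Implicit Defensive.

Import Order.TTheory GRing.Theory Num.Theory.
Import numFieldNormedType.Exports.

Local Open Scope classical_set_scope.
Local Open Scope ring_scope.

(** Write [Lam x] for the length of the shortest path tree at depth less than
[x], and [rho] for the competitive ratio of any randomized search.  The theorem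
follows from one lower bound on [rho], namely that the integral of [Lam] from 0
to [x] is at most [rho * x ^+ 2 / 2] for all [x > 0], and from an upper bound
on the expected search time of a point by averages of [Lam].

Lower bound ([moment_bound]).  Let the Hider choose a point of the tree at
depth less than [x], with a probability proportional to length.  By time [t] an
expanding search has found at most the length [t], so the mean search time is
at least [Lam x / 2]; it is also at most [rho] times the mean depth, and the
inequality between arithmetic and geometric means gives the claim.  Search times
need not be jointly measurable in the search and in the hiding place, so the
Hider uses a finite grid, and the inequality comes from a sum of finitely many
expectations ([hider_bound]).  That a search cannot pick the points of the grid
alone is due to the connectedness of the searched sets: a connected set that
contains the root enters an arc from its ends ([connected_arc_side]), hence
contains one cell of the grid for each point found ([found_length]).  Lengths in
the tree and in the network are compared by [packing_proj]: arcs of the tree are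
isometric and disjoint pieces of arcs of the network.

Upper bound ([visit_time_rev]).  Let [y] have depth [x] in the stratum between
the thresholds [a] and [b].  A point of the stratum that is visited before [y]
both by the depth-first search and by its reverse is an ancestor of [y], and the
ancestors of [y] in the stratum have length at most [x - a].  So the expectation
over the coin of the search time of [y] is at most
[(Lam a + Lam b + x - a) / 2], whatever the depth-first search.  The term
[(x - a) / 2] accounts for the summand 1/2.

Expectation ([expected_search_time_scale]).  If [p <= x < 2 * p] with [p] a
power of 2, then [y] belongs to one of two iterations, according to whether the
threshold drawn between [p] and [2 * p] exceeds [x].  The thresholds are uniform
and independent, so the expectation of [Lam a + Lam b] is a combination of
integrals of [Lam] over dyadic intervals, and the lower bound makes it at most
[5 / 2 * rho * x].  Almost all of [Lam] is carried by finitely many arcs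
([below_approx]), which leaves piecewise quadratic antiderivatives to handle. *)

(** * Distances in a metric graph *)

Section Metric.
Variables (R : realType) (Q : metric_graph R).
Implicit Types (x y z : gpoint Q) (e : garc Q).

Lemma joined_ge0 x y l : joined x y l -> 0 <= l.
Proof. by elim=> [//|*]; rewrite addr_ge0. Qed.

Lemma joined_trans x y z l m :
  joined x y l -> joined y z m -> joined x z (l + m).
Proof.
move=> xy; elim=> [|u v k e s t _ IH es et]; first by rewrite addr0.
by rewrite addrA; apply: joined_step IH es et.
Qed.

Lemma joined_arc e s t y z : on_arc e s y -> on_arc e t z ->
  joined y z `|t - s|.
Proof.
by move=> es et; rewrite -[X in joined _ _ X]add0r;
  apply: joined_step es et; exact: joined_refl.
Qed.

Lemma joined_sym x y l : joined x y l -> joined y x l.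
Proof.
elim=> [|u v k e s t _ IH es et]; first exact: joined_refl.
by rewrite addrC distrC; apply: joined_trans IH; exact: joined_arc et es.
Qed.

Lemma gdist_le x y l : joined x y l -> gdist x y <= l.
Proof.
by move=> xyl; apply: ge_inf => //; exists 0 => m /= /joined_ge0.
Qed.

Lemma gdist_ge0 x y : 0 <= gdist x y.
Proof.
rewrite /gdist; have [->|/set0P ne] := eqVneq [set l | joined x y l] set0.
  by rewrite inf0.
apply: lb_le_inf => // l /=; exact: joined_ge0.
Qed.

Lemma depth_ge0 x : 0 <= depth x.
Proof. exact: gdist_ge0. Qed.

Lemma depth_origin : depth (origin Q) = 0.
Proof.
by apply/eqP; rewrite eq_le depth_ge0 andbT gdist_le//; exact: joined_refl.
Qed.

Hypothesis cQ : connected_graph Q.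

Lemma connected_joined x y : exists l, joined x y l.
Proof.
have [[l xl] [m ym]] := (cQ x, cQ y); exists (l + m).
exact: joined_trans (joined_sym xl) ym.
Qed.

Lemma le_gdist x y c : (forall l, joined x y l -> c <= l) -> c <= gdist x y.
Proof. by move=> cl; apply: lb_le_inf => //; exact: connected_joined. Qed.

Lemma gdist_triangle x y z : gdist x z <= gdist x y + gdist y z.
Proof.
rewrite -lerBlDr; apply: le_gdist => l xy.
rewrite lerBlDr -lerBlDl; apply: le_gdist => m yz.
by rewrite lerBlDl; apply: gdist_le; exact: joined_trans xy yz.
Qed.

(** Paths are made of pieces of arcs, so a Lipschitz bound needs checking along
arcs only; all lower bounds on distances are obtained in this way. *)
Lemma lipschitz_joined (f : gpoint Q -> R) :
  (forall e s t y z, on_arc e s y -> on_arc e t z -> f y - f z <= `|s - t|) ->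
  forall x y l, joined x y l -> f x - f y <= l.
Proof.
move=> fL x y l; elim=> [|u v k e s t _ IH es et]; first by rewrite subrr.
have := lerD IH (fL _ _ _ _ _ es et); rewrite addrA subrK => /le_trans; apply.
by rewrite distrC.
Qed.

Lemma lipschitz_gdist (f : gpoint Q -> R) :
  (forall e s t y z, on_arc e s y -> on_arc e t z -> f y - f z <= `|s - t|) ->
  forall x y, f x - f y <= gdist x y.
Proof.
by move=> fL x y; apply: le_gdist => l; exact: lipschitz_joined.
Qed.

(** ** Interior points of an arc *)

(** Outside the interior of the arc the value is a dummy. *)
Definition ipt e (t : R) : gpoint Q :=
  if insub (e, t) is Some p then inr p else origin Q.

Lemma on_arc_ipt e t : 0 < t -> (t%:E < len e)%E -> on_arc e t (ipt e t).
Proof.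
by move=> t0 tl; rewrite /ipt insubT //=; rewrite t0 tl.
Qed.

Lemma on_arc_interior e t x : 0 < t -> (t%:E < len e)%E -> on_arc e t x ->
  x = ipt e t.
Proof.
move=> t0 tl; case: x => [v|p].
  by case=> -[h _]; [rewrite h ltxx in t0|rewrite h ltxx in tl].
by move=> /= pE; rewrite /ipt -[(e, t)]pE valK.
Qed.

Lemma ipt_inj e e' t t' : 0 < t -> (t%:E < len e)%E ->
  0 < t' -> (t'%:E < len e')%E -> ipt e t = ipt e' t' -> e = e' /\ t = t'.
Proof.
move=> t0 tl t0' tl'; rewrite /ipt !insubT /= ?t0 ?tl ?t0' ?tl'//.
by move=> tl2 tl2' [-> ->].
Qed.

Lemma ipt_neq_vertex e t v : 0 < t -> (t%:E < len e)%E -> ipt e t <> inl v.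
Proof. by move=> t0 tl; rewrite /ipt insubT /= ?t0 ?tl. Qed.

Lemma gpointP x : (exists v, x = inl v) \/
  exists e t, [/\ 0 < t, (t%:E < len e)%E & x = ipt e t].
Proof.
case: x => [v|[[e t] /= Hp]]; [by left; exists v|right].
by exists e, t; case/andP: (Hp) => t0 tl; split => //; rewrite /ipt insubT.
Qed.

(** Functions that vary along a single arc: when they are Lipschitz, they bound
from below the distances to the points of that arc. *)
Definition arc_fun e (g : R -> R) (c : R) x : R :=
  if x is inr p then if (val p).1 == e then g (val p).2 else c else c.

Lemma arc_fun_on_arc e g c : g 0 = c -> (forall t, t%:E = len e -> g t = c) ->
  forall e' t x, on_arc e' t x ->
  arc_fun e g c x = if e' == e then g t else c.
Proof.
move=> g0 gl e' t [v|p] /= => [|-> //].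
by case=> -[h _]; case: eqP => // ee; [rewrite h|rewrite gl// h ee].
Qed.

Lemma arc_fun_lipschitz e g c : g 0 = c ->
  (forall t, t%:E = len e -> g t = c) ->
  (forall s t, g s - g t <= `|s - t|) ->
  forall x y, arc_fun e g c x - arc_fun e g c y <= gdist x y.
Proof.
move=> g0 gl gL; apply: lipschitz_gdist => e' s t y z es et.
rewrite (arc_fun_on_arc g0 gl es) (arc_fun_on_arc g0 gl et).
by case: eqP => // _; rewrite subrr.
Qed.

Lemma arc_fun_ipt e g c t : 0 < t -> (t%:E < len e)%E ->
  arc_fun e g c (ipt e t) = g t.
Proof. by move=> t0 tl; rewrite /ipt insubT /= ?t0 ?tl// eqxx. Qed.

Definition tent (a b t : R) : R := Num.max 0 (Num.min (t - a) (b - t)).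

Lemma tent_lipschitz a b s t : tent a b s - tent a b t <= `|s - t|.
Proof.
rewrite /tent; have h1 := ler_norm (s - t); have := ler_norm (t - s); rewrite distrC => h2.
case: (leP (s - a) (b - s)) => ?; case: (leP (t - a) (b - t)) => ?;
  by do 2![case: (leP 0 (_ - _)) => ?]; lra.
Qed.

Lemma tent0 a b t : t <= a \/ b <= t -> tent a b t = 0.
Proof.
by rewrite /tent; case: (leP (t - a)) => ? [] ?; case: leP => ?; lra.
Qed.

Lemma tent_gt0 a b t : a < t < b -> 0 < tent a b t.
Proof. by case/andP=> ? ?; rewrite /tent lt_max lt_min !subr_gt0; lra. Qed.

(** A neighbourhood of an interior point is an interval of its arc: the tent
function over that interval is Lipschitz and vanishes elsewhere. *)
Lemma near_ipt e a b t y : 0 <= a -> (b%:E <= len e)%E -> a < t < b ->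
  gdist (ipt e t) y < tent a b t ->
  exists2 s, a < s < b & y = ipt e s.
Proof.
move=> a0 bl atb yt.
have [at_ tb] := andP atb.
have t0 : 0 < t by lra.
have tl : (t%:E < len e)%E by apply: lt_le_trans bl; rewrite lte_fin.
have g0 : tent a b 0 = 0 by apply: tent0; left.
have gl s : s%:E = len e -> tent a b s = 0.
  by move=> sl; apply: tent0; right; rewrite -lee_fin sl.
have := arc_fun_lipschitz g0 gl (tent_lipschitz a b) (ipt e t) y.
rewrite arc_fun_ipt// => h.
have {h} : 0 < arc_fun e (tent a b) 0 y by lra.
case: y yt => [v|[[e' s] /= Hp]] _; rewrite /arc_fun/= ?ltxx//.
case: eqP => [ee|]; last by rewrite ltxx.
subst e'; have [sa|sa] := leP s a; first by rewrite tent0 ?ltxx//; left.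
have [sb|sb] := leP b s; first by rewrite tent0 ?ltxx//; right.
by move=> _; exists s; [rewrite sa|rewrite /ipt insubT].
Qed.

Lemma gdist0_ipt e t y : 0 < t -> (t%:E < len e)%E ->
  gdist (ipt e t) y = 0 -> y = ipt e t.
Proof.
move=> t0 tl y0.
have [b tb bl] : exists2 b, t < b & (b%:E <= len e)%E.
  case: (len e) tl => [l||] //; first by rewrite lte_fin; exists l.
  by exists (t + 1); rewrite ?ltrDl// leey.
have near a c : 0 <= a -> a < t < c -> (c%:E <= len e)%E ->
    exists2 s, a < s < c & y = ipt e s.
  by move=> a0 atc cl; apply: (near_ipt a0 cl atc); rewrite y0 tent_gt0.
have [//||//|s /andP[s0 sb] yE] := near 0 b; first by rewrite t0.
have sl : (s%:E <= len e)%E by apply: le_trans bl; rewrite lee_fin ltW.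
have sl' : (s%:E < len e)%E by apply: lt_le_trans bl; rewrite lte_fin.
have absurd u : 0 < u -> u < b -> y = ipt e u -> s = u.
  move=> u0 ub; rewrite yE => /ipt_inj[]//.
  by apply: lt_le_trans bl; rewrite lte_fin.
have [st|ts|<-//] := ltgtP s t.
- have [||//|u /andP[su ub]] := near s b; [exact: ltW|by rewrite st|].
  move=> yu; have us : s = u by apply: absurd yu => //; exact: lt_trans su.
  by rewrite us ltxx in su.
- have [//||//|u /andP[u0 us]] := near 0 s; first by rewrite t0.
  move=> yu; have su : s = u by apply: absurd yu => //; exact: lt_trans sb.
  by rewrite su ltxx in us.
Qed.

(** The distance to the closed segment between [a] and [b] on an arc, cut off
at [c]. *)
Definition valley (a b c t : R) : R :=
  Num.min c (Num.max 0 (Num.max (a - t) (t - b))).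

Lemma valley_lipschitz a b c s t : valley a b c s - valley a b c t <= `|s - t|.
Proof.
rewrite /valley; have h1 := ler_norm (s - t); have := ler_norm (t - s).
rewrite distrC => h2.
case: (leP (a - s) (s - b)) => ?; case: (leP (a - t) (t - b)) => ?;
  do 2![case: (leP 0 (_ - _)) => ?]; do ?[case: (leP c _) => ?]; lra.
Qed.

Lemma open_gpoint (U : set (gpoint Q)) :
  (forall x, U x -> exists2 r : R, 0 < r & forall y, gdist x y < r -> U y) ->
  open U.
Proof. by move=> oU; exact: (oU : point_open U). Qed.

Lemma open_arc_segment e a b : 0 <= a -> (b%:E <= len e)%E ->
  open [set x | exists2 s, a < s < b & x = ipt e s].
Proof.
move=> a0 bl; apply: open_gpoint => x [t atb ->]; exists (tent a b t); first exact: tent_gt0.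
by move=> y; exact: near_ipt.
Qed.

Lemma closed_arc_segment e a b : 0 < a -> a < b -> (b%:E < len e)%E ->
  closed [set x | exists2 s, a <= s <= b & x = ipt e s].
Proof.
move=> a0 ab bl; rewrite -openC; apply: open_gpoint => x xab.
have [c [c0 ca cl]] : exists c, [/\ 0 < c, c <= a &
    forall l, l%:E = len e -> c <= l - b].
  case: (len e) bl => [l||//] bl; last by exists a.
  rewrite lte_fin in bl.
  exists (Num.min a (l - b)); split.
  - by rewrite lt_min a0 subr_gt0.
  - by rewrite ge_min lexx.
  - by move=> _ [->]; rewrite ge_min lexx orbT.
have g0 : valley a b c 0 = c.
  by rewrite /valley subr0; apply/min_idPl; rewrite !le_max ca orbT.
have gl s : s%:E = len e -> valley a b c s = c.
  by move=> /cl h; apply/min_idPl; rewrite !le_max h !orbT.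
pose f := arc_fun e (valley a b c) c.
have f0 y : [set x | exists2 s, a <= s <= b & x = ipt e s] y -> f y = 0.
  move=> [s /andP[as_ sb] ->]; rewrite /f arc_fun_ipt; last 2 first.
  - exact: lt_le_trans as_.
  - by apply: le_lt_trans bl; rewrite lee_fin.
  rewrite /valley (max_idPl _) ?ge_max ?subr_le0 ?as_ ?sb//.
  exact/min_idPr/ltW.
have fx : 0 < f x.
  rewrite /f; case: x xab => [v|[[e' s] /= Hp]] xab; rewrite /arc_fun//=.
  case: eqP => // ee; subst e'; rewrite /valley lt_min c0 !lt_max !subr_gt0 ltxx/=.
  have [//|as_] := ltP s a; have [//|sb] := ltP b s.
  case: xab; exists s; first by rewrite as_ sb.
  by rewrite /ipt insubT.
exists (f x) => // y xy /f0 fy.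
have := arc_fun_lipschitz g0 gl (valley_lipschitz a b c) x y.
by rewrite -/f fy subr0 leNgt xy.
Qed.

(** If a point were missing on each side, the segment between the two missing
points would cut the set into a part that is open and closed in it and does not
contain the root, and the rest. *)
Lemma connected_arc_side (S : set (gpoint Q)) e t :
  connected S -> S (origin Q) -> 0 < t -> (t%:E < len e)%E -> S (ipt e t) ->
  (forall s, 0 < s <= t -> S (ipt e s)) \/
  (forall s, t <= s -> (s%:E < len e)%E -> S (ipt e s)).
Proof.
move=> cS SO t0 tl St; apply: contrapT => /not_orP[].
move=> /existsNP[a /not_implyP[/andP[a0 at_] Sa]].
move=> /existsNP[b /not_implyP[tb /not_implyP[bl Sb]]].
have {}at_ : a < t.
  by rewrite lt_neqAle at_ andbT; apply: contra_notN Sa => /eqP->.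
have {}tb : t < b.
  by rewrite lt_neqAle tb andbT; apply: contra_notN Sb => /eqP<-.
pose B := S `&` [set x | exists2 s, a < s < b & x = ipt e s].
have BS : B = S.
  apply: cS.
  - by exists (ipt e t); split => //; exists t; rewrite ?at_.
  - by exists [set x | exists2 s, a < s < b & x = ipt e s] => //;
      apply: open_arc_segment (ltW bl); exact: ltW.
  - exists [set x | exists2 s, a <= s <= b & x = ipt e s].
      by apply: closed_arc_segment => //; exact: lt_trans tb.
    apply/seteqP; split => x [Sx [s /andP[as_ sb] xE]]; split => //; exists s => //.
      by rewrite !ltW.
    rewrite !lt_neqAle as_ sb !andbT; apply/andP; split.
      by apply: contra_notN Sa => /eqP->; rewrite -xE.
    by apply: contra_notN Sb => /eqP<-; rewrite -xE.
have := SO; rewrite -BS => -[_ [s /andP[as_ sb]]].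
move=> /esym/ipt_neq_vertex; apply; first exact: lt_trans as_.
by apply: lt_trans bl; rewrite lte_fin.
Qed.

End Metric.

(** * Depth along the arcs of a metric tree *)

Section Tree.
Variables (R : realType) (T : metric_graph R).
Implicit Types (v : vertex T) (e : garc T) (a : garc T * bool).

Definition wlen (w : seq (garc T * bool)) : R := \sum_(a <- w) fine (len a.1).

Definition astart a := if a.2 then src a.1 else tgt a.1.
Definition aend a := if a.2 then tgt a.1 else src a.1.

Lemma is_walk_rcons u w a v : is_walk u (rcons w a) v <->
  [/\ is_walk u w (astart a), (len a.1 < +oo)%E & v = aend a].
Proof.
case: a => e' b'; elim: w u => [|[e b] w IH] u /=.
  by split=> [[? -> <-]|[-> ? ->]].
split=> [[? -> /IH[? ? ->]]|[[? -> ?] ? vE]]; first by split.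
by split=> //; apply/IH.
Qed.

Lemma reduced_rcons w b a :
  reduced (rcons (rcons w b) a) =
  reduced (rcons w b) && (a != (b.1, ~~ b.2)).
Proof. by case: w => [|c w]; rewrite /reduced /= ?andbT// !rcons_path last_rcons. Qed.

Lemma fineK_len e : (len e < +oo)%E -> (fine (len e))%:E = len e.
Proof. by move=> el; rewrite fineK// ge0_fin_numE// ltW// len_gt0. Qed.

Lemma on_arc_src e : on_arc e 0 (inl (src e)).
Proof. by left. Qed.

Lemma on_arc_tgt e : (len e < +oo)%E -> on_arc e (fine (len e)) (inl (tgt e)).
Proof. by move=> /fineK_len el; right. Qed.

Lemma walk_joined u w v : is_walk u w v ->
  @joined R T (inl u) (inl v) (wlen w).
Proof.
elim: w u => [|[e b] w IH] u /=.
  by move=> ->; rewrite /wlen big_nil; exact: joined_refl.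
move=> [el -> /IH wv]; rewrite /wlen big_cons.
apply: joined_trans wv; have l0 : 0 <= fine (len e).
  by rewrite fine_ge0// ltW// len_gt0.
rewrite -(ger0_norm l0) -[X in `|X|]subr0; case: b.
  exact: joined_arc (on_arc_src e) (on_arc_tgt el).
by rewrite distrC; exact: joined_arc (on_arc_tgt el) (on_arc_src e).
Qed.

Definition redwalk v w := is_walk (rootv T) w v /\ reduced w.

(** Appending an arc keeps a walk reduced, unless the walk has just traversed
that arc the other way; the prefix without that last step is then the walk
looked for. *)
Lemma redwalk_extend a w : redwalk (astart a) w -> (len a.1 < +oo)%E ->
  exists2 w', redwalk (aend a) w' &
    w' = rcons w a \/ w = rcons w' (a.1, ~~ a.2).
Proof.
case: (lastP w) => [|{}w b] [walk red] al.
  by exists [:: a]; [split => //; case: a walk al => e b /= -> ?; split|left].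
have [ab|ab] := eqVneq a (b.1, ~~ b.2).
  exists w; last by rewrite ab/= negbK; right; case: (b).
  have [w1 _ _] := (is_walk_rcons _ _ _ _).1 walk; split.
    by move: w1; rewrite ab /aend /astart /=; case: (b.2).
  case: (w) red => [//|c s]; rewrite /reduced /= rcons_path => /andP[]//.
exists (rcons (rcons w b) a); last by left.
by split; [apply/is_walk_rcons|rewrite reduced_rcons red].
Qed.

Hypothesis treeT : metric_tree T.

Lemma redwalk_unique v w w' : redwalk v w -> redwalk v w' -> w = w'.
Proof. by move=> [a b] [c d]; exact: (treeT.2 _ _ _ a b c d). Qed.

Lemma redwalk_arc e : (len e < +oo)%E ->
  (exists w, redwalk (src e) w) <-> (exists w, redwalk (tgt e) w).
Proof.
move=> el; split=> -[w ww].
  by have [w' ? _] := @redwalk_extend (e, true) w ww el; exists w'.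
by have [w' ? _] := @redwalk_extend (e, false) w ww el; exists w'.
Qed.

Lemma redwalk_exists v : exists w, redwalk v w.
Proof.
have [l] := treeT.1 (inl v).
suff reach x m : joined (origin T) x m ->
    (forall u, x = inl u -> exists w, redwalk u w) /\
    (forall e t, on_arc e t x -> exists w, redwalk (src e) w).
  by move=> /reach[+ _]; apply.
elim=> [|y z k e s t _ [_ IH] es et].
  have root : exists w, redwalk (rootv T) w by exists [::].
  split=> [u [<-]//|e t [] [te re]]; first by rewrite -re.
  by apply/redwalk_arc; rewrite -?re// -te ltry.
have sw := IH _ _ es; have vw u : z = inl u -> exists w, redwalk u w.
  move=> zE; move: et; rewrite zE => -[] [tE ->] //.
  by apply/redwalk_arc; rewrite // -tE ltry.
split=> // e' t' et'; case: z et et' vw => [u|p] /=.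
  move=> _ [] [t'E uE] /(_ _ erefl); rewrite uE//.
  by move=> /redwalk_arc; apply; rewrite -t'E ltry.
by move=> -> [<-].
Qed.

Definition rootwalk v : seq (garc T * bool) :=
  projT1 (cid (redwalk_exists v)).

Lemma rootwalkP v : redwalk v (rootwalk v).
Proof. exact: projT2 (cid (redwalk_exists v)). Qed.

Definition vheight v : R := wlen (rootwalk v).

Lemma vheight_arc e : (len e < +oo)%E ->
  vheight (tgt e) = vheight (src e) + fine (len e) \/
  vheight (src e) = vheight (tgt e) + fine (len e).
Proof.
move=> el; have [w ww] := @redwalk_extend (e, true) _ (rootwalkP (src e)) el.
rewrite (redwalk_unique ww (rootwalkP (tgt e))) /vheight /wlen.
by case=> ->; [left|right]; rewrite -cats1 big_cat big_seq1.
Qed.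

(** Walking away from the root, the arc is crossed from [tgt e] to [src e]. *)
Definition inward e : bool :=
  (len e < +oo)%E && (vheight (src e) == vheight (tgt e) + fine (len e)).

Definition near_height e := vheight (if inward e then tgt e else src e).

Definition arc_height e (t : R) : R :=
  near_height e + if inward e then fine (len e) - t else t.

Definition height (x : gpoint T) : R :=
  match x with inl v => vheight v | inr p => arc_height (val p).1 (val p).2 end.

Lemma height_on_arc e t x : on_arc e t x -> height x = arc_height e t.
Proof.
case: x => [v|p] /=; last by move->.
rewrite /arc_height /near_height; case=> -[tE ->]; case: ifPn => ein.
- by case/andP: ein => _ /eqP->; rewrite tE subr0.
- by rewrite tE addr0.
- by rewrite -tE /= subrr addr0.
- have el : (len e < +oo)%E by rewrite -tE ltry.
  move: ein; rewrite /inward el /= => /eqP.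
  by have [->|//] := vheight_arc el; rewrite -tE.
Qed.

(** The height is 1-Lipschitz along arcs, so no path is shorter than it; the
unique reduced walk attains it. *)
Lemma depth_height x : depth x = height x.
Proof.
apply/eqP; rewrite eq_le; apply/andP; split.
  have vle v : joined (origin T) (inl v) (vheight v).
    exact: walk_joined (rootwalkP v).1.
  case: (gpointP x) => [[v ->]|[e [t [t0 tl ->]]]]; first exact/gdist_le/vle.
  have et := on_arc_ipt t0 tl; rewrite (height_on_arc et); apply: gdist_le.
  rewrite /arc_height /near_height; case: ifPn => [/andP[el _]|_].
    have tle : t <= fine (len e) by rewrite -lee_fin fineK_len// ltW.
    rewrite -(@ger0_norm _ (_ - t)) ?subr_ge0// distrC.
    by apply: joined_step (on_arc_tgt el) et.
  rewrite -[t in _ + t](@ger0_norm _ t) ?ltW// -[X in `|X|]subr0.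
  by apply: joined_step (on_arc_src e) et.
have h0 : height (origin T) = 0.
  rewrite /= /vheight (redwalk_unique (rootwalkP _) (_ : redwalk _ [::]))//.
  by rewrite /wlen big_nil.
rewrite -[leLHS]subr0 -h0 /depth; apply: le_gdist; first exact: treeT.1.
move=> l /joined_sym; apply: lipschitz_joined => e s t y z es et.
rewrite (height_on_arc es) (height_on_arc et) /arc_height.
have h1 := ler_norm (s - t); have := ler_norm (t - s); rewrite distrC => h2.
by case: ifP => _; lra.
Qed.

(** [D e] is the depth of the end of [e] that is nearer to the root, and [o e]
says that this end is [tgt e]. *)
Definition outward_depth (D : garc T -> R) (o : garc T -> bool) : Prop :=
  forall e, [/\ 0 <= D e, o e -> (len e < +oo)%E & forall t y, on_arc e t y ->
    depth y = D e + if o e then fine (len e) - t else t].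

(** In a general graph the depth may rise and then fall along an arc; in a tree
one end of an arc can only be reached through the other. *)
Lemma tree_outward_depth : exists D o, outward_depth D o.
Proof.
exists near_height, inward => e; split.
- by have := depth_ge0 (inl (if inward e then tgt e else src e));
    rewrite depth_height.
- by case/andP.
- by move=> t y /height_on_arc; rewrite depth_height.
Qed.

End Tree.

(** * Packing pieces of arcs *)

Section Packing.
Variable R : realType.
Local Notation leb := (@lebesgue_measure R).

Lemma le_lebesgue (A B : set R) : A `<=` B -> (leb A <= leb B)%E.
Proof.
move=> AB.
rewrite /lebesgue_measure/= /lebesgue_stieltjes_measure/= /measure_extension/=.
exact: le_mu_ext.
Qed.

Lemma sum_le_esum (I : choiceType) (f : I -> \bar R) (s : seq I) : uniq s ->
  (\sum_(i <- s) f i <= \esum_(i in setT) f i)%E.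
Proof.
move=> us; apply: esum_ge; exists [set` s]; last by rewrite -fsbig_seq.
by split => //; exact: finite_seq.
Qed.

Lemma esum_le_sum (I : choiceType) (f : I -> \bar R) (c : \bar R) :
  (forall s, uniq s -> \sum_(i <- s) f i <= c)%E ->
  (\esum_(i in setT) f i <= c)%E.
Proof.
move=> fc; apply: ge_ereal_sup => _ [X [finX _] <-].
by rewrite fsbig_finite//; apply: fc; exact: finmap.fset_uniq.
Qed.

Definition affine (c : R) (b : bool) (t : R) : R := c + (-1) ^+ b * t.

Lemma affineK c b : cancel (affine c b) (fun t => (-1) ^+ b * (t - c)).
Proof. by case: b => t; rewrite /affine /=; ring. Qed.

Lemma affine_inj c b : injective (affine c b).
Proof. exact: can_inj (affineK c b). Qed.

Lemma measurable_affine c b : measurable_fun setT (affine c b).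
Proof.
by apply: measurable_funD => //; apply: measurable_funM => //; exact: measurable_id.
Qed.

Lemma image_affine c b (E : set R) :
  affine c b @` E = affine (- (-1) ^+ b * c) b @^-1` E.
Proof.
apply/seteqP; split => [_ [t Et <-]|t /= Et].
  by rewrite /preimage/=; congr E: Et; rewrite /affine; case: b; ring.
by exists (affine (- (-1) ^+ b * c) b t) => //; rewrite /affine; case: b {Et}; ring.
Qed.

Lemma measurable_affine_image c b (E : set R) :
  measurable E -> measurable (affine c b @` E).
Proof.
move=> mE; rewrite image_affine -[X in measurable X]setTI.
exact: measurable_affine.
Qed.

Lemma lebesgue_affine_image c b (E : set R) :
  measurable E -> leb (affine c b @` E) = leb E.
Proof.
move=> mE; rewrite image_affine; set a := - _ * c.
transitivity (pushforward leb (affine a b : _ -> measurableTypeR R) E) => //.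
apply/esym/lebesgue_measure_unique => //=; first exact: measurable_affine.
move=> _ _ [[u v] _ <-].
rewrite /pushforward/= lebesgue_measure_itv/= lte_fin.
rewrite (_ : _ @^-1` _ =
  [set` (if b then `[a - v, a - u[ else `]u - a, v - a])%R]); last first.
  apply/seteqP; split => t; rewrite /affine /= in_itv/=;
    case: b {a} (a) => a /=; rewrite in_itv/= => /andP[? ?]; apply/andP; lra.
rewrite lebesgue_measure_itv; case: b {a} (a) => a /=; rewrite lte_fin.
  by rewrite ltrD2l ltrN2; case: ifP => // _; rewrite -!EFinB; congr EFin; ring.
by rewrite ltrD2r; case: ifP => // _; rewrite -!EFinB; congr EFin; ring.
Qed.

(** The copies of the [E i] inside one [B k] are measurable and disjoint, so that
their measures add up; [B k] itself only enters through the monotonicity of the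
outer measure.  This compares lengths in the tree with lengths in the network,
and the length of a set of ancestors with a range of depths. *)
Lemma packing (I K : choiceType) (s : seq I) (q : I -> K) (c : I -> R)
    (b : I -> bool) (E : I -> set R) (B : K -> set R) :
  uniq s -> (forall i, measurable (E i)) ->
  (forall i t, i \in s -> E i t -> B (q i) (affine (c i) (b i) t)) ->
  (forall i j t u, i \in s -> j \in s -> E i t -> E j u -> q i = q j ->
     affine (c i) (b i) t = affine (c j) (b j) u -> i = j) ->
  (\sum_(i <- s) leb (E i) <= \esum_(k in setT) leb (B k))%E.
Proof.
move=> us mE EB Einj.
pose E' i := affine (c i) (b i) @` E i.
apply: (@le_trans _ _
  (\esum_(k in setT) \sum_(i <- s | q i == k) leb (E' i))%E).
  under eq_esum do rewrite big_mkcond/=.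
  rewrite esum_sum; last by move=> k i _ _; case: ifP.
  apply: lee_sum => i _.
  rewrite (_ : (fun k => _) =
      fun k => if k \in [set q i] then leb (E' i) else 0%E); last first.
    apply/funext => k; have [<-|qk] := eqVneq (q i) k; first by rewrite mem_set.
    by rewrite memNset// => /esym/eqP; exact/negP.
  by rewrite -esum_mkcond esum_set1// lebesgue_affine_image.
apply: le_esum => k _; rewrite -big_filter.
set sk := [seq i <- s | q i == k].
have usk : uniq sk by exact: filter_uniq.
have skE i : i \in sk -> i \in s /\ q i = k.
  by rewrite mem_filter => /andP[/eqP ? ?].
rewrite fsbig_seq// -measure_fin_bigcup//=.
- apply: le_lebesgue => _ [i /= /skE[si <-] [t Et <-]]; exact: EB.
- apply/trivIsetP => i j /= /skE[si qi] /skE[sj qj] /eqP ij.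
  apply/seteqP; split => // _ [[t Et <-] [u Eu]] /esym tu.
  by apply: ij; apply: Einj Et Eu _ tu => //; rewrite qi.
- by move=> i _; exact: measurable_affine_image.
Qed.

End Packing.

(** * Parametrising the arcs of a tree away from the root *)

Section Away.
Variables (R : realType) (T : metric_graph R).
Variables (D : garc T -> R) (o : garc T -> bool).
Hypothesis arc_depth : outward_depth D o.
Local Notation leb := (@lebesgue_measure R).
Implicit Types (e : garc T) (s : R).

Definition inner e s : Prop := 0 < s /\ (s%:E < len e)%E.

(** The parameter is the distance to the end of the arc nearer to the root. *)
Definition away e : R -> gpoint T :=
  ipt e \o affine (if o e then fine (len e) else 0) (o e).

Lemma inner_away e s : inner e s ->
  inner e (affine (if o e then fine (len e) else 0) (o e) s).
Proof.
have [_ oe _] := arc_depth e; move=> [s0 sl]; rewrite /affine.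
case: (o e) oe => oe; last by rewrite add0r expr0 mul1r.
have lE := fineK_len (oe isT); move: sl; rewrite /inner -lE !lte_fin expr1.
by split; lra.
Qed.

Lemma on_arc_away e s : inner e s ->
  on_arc e (affine (if o e then fine (len e) else 0) (o e) s) (away e s).
Proof. by move=> /inner_away[? ?]; exact: on_arc_ipt. Qed.

Lemma depth_away e s : inner e s -> depth (away e s) = D e + s.
Proof.
move=> /on_arc_away es; have [_ _ /(_ _ _ es)->] := arc_depth e.
by rewrite /affine; case: (o e); rewrite /= ?expr0 ?expr1; ring.
Qed.

Lemma away_inj e e' s s' : inner e s -> inner e' s' ->
  away e s = away e' s' -> e = e' /\ s = s'.
Proof.
move=> es es'; have [s0 sl] := inner_away es; have [s0' sl'] := inner_away es'.
move=> /ipt_inj[]// ee; subst e'.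
by move=> /affine_inj.
Qed.

Lemma away_surj e t : inner e t ->
  exists2 s, inner e s & ipt e t = away e s.
Proof.
move=> et; exists (affine (if o e then fine (len e) else 0) (o e) t).
  exact: inner_away.
rewrite /away /=; congr ipt; rewrite /affine; case: (o e); rewrite ?expr1; ring.
Qed.

Definition trace (A : set (gpoint T)) e : set R :=
  [set s | inner e s /\ A (away e s)].

Lemma lambda_le_away (A : set (gpoint T)) (E : garc T -> set R) :
  (forall e, measurable (E e)) -> (forall e, trace A e `<=` E e) ->
  (lambda A <= \esum_(e in setT) leb (E e))%E.
Proof.
move=> mE AE; apply: le_esum => e _.
pose E' := affine (if o e then fine (len e) else 0) (o e) @` E e.
have mE' : measurable E' by exact: measurable_affine_image.
have mF : measurable ([set 0; fine (len e)] : set R).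
  by apply: measurableU; exact: measurable_set1.
apply: (@le_trans _ _ (leb (E' `|` [set 0; fine (len e)]))).
  apply: le_lebesgue => t [x Ax et].
  have [t0|] := pselect (inner e t); last first.
    move=> nt; right; case: x {Ax} et nt => [v|p] /=.
      by move=> -[] [tE _] _; [left|right => /=; rewrite -tE].
    by move=> pE; case; have := valP p; rewrite /= pE => /andP[].
  left; have [s es sE] := away_surj t0; exists s.
    by apply: AE; split => //; rewrite -sE -(on_arc_interior t0.1 t0.2 et).
  move: sE => /ipt_inj; have [? ?] := inner_away es; case: t0 => ? ?.
  by case.
have leb0 : leb [set 0; fine (len e)] = 0%E.
  apply/eqP; rewrite eq_le measure_ge0 andbT.
  have := measureU2 (@lebesgue_measure R) (@measurable_set1 R 0)
    (@measurable_set1 R (fine (len e))).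
  by rewrite /= !lebesgue_measure_set1 adde0.
have := measureU2 (@lebesgue_measure R) mE' mF.
by rewrite /= leb0 adde0 lebesgue_affine_image.
Qed.

Lemma lambda_away (A : set (gpoint T)) :
  (forall e, measurable (trace A e)) ->
  lambda A = (\esum_(e in setT) leb (trace A e))%E.
Proof.
move=> mA; apply/eqP; rewrite eq_le (lambda_le_away mA (fun=> @subset_refl _ _))/=.
apply: le_esum => e _.
rewrite -(lebesgue_affine_image (if o e then fine (len e) else 0) (o e) (mA e)).
apply: le_lebesgue => _ [s [es As] <-].
by exists (away e s) => //; exact: on_arc_away.
Qed.

Lemma le_lambda (G : metric_graph R) (A B : set (gpoint G)) :
  A `<=` B -> (lambda A <= lambda B)%E.
Proof.
by move=> AB; apply: le_esum => e _; apply: le_lebesgue => t [x /AB]; exists x.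
Qed.

(** ** The isometric image in the network *)

Variables (Q : metric_graph R) (proj : gpoint T -> gpoint Q).
Hypothesis spt : shortest_path_tree proj.

Lemma on_arc_range (e : garc Q) t x :
  on_arc e t x -> 0 <= t /\ (t%:E <= len e)%E.
Proof.
case: x => [v|p] /=.
  by case=> -[tE _]; split; rewrite -?tE ?tE// ?(ltW (len_gt0 e))//;
    rewrite -lee_fin tE ltW// len_gt0.
by move=> pE; have := valP p; rewrite /= pE => /andP[/ltW ? /ltW].
Qed.

(** An interior point has neighbours on both sides that stay on the same arc of
the network, so its image is not an end of that arc. *)
Lemma proj_away e : exists (q : garc Q) (c : R) (b : bool), forall s,
  inner e s -> [/\ 0 < affine c b s, ((affine c b s)%:E < len q)%E &
    proj (away e s) = ipt q (affine c b s)].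
Proof.
have [q [a [b qP]]] := spt_arc spt e.
pose a0 := affine (if o e then fine (len e) else 0) (o e) 0.
exists q, (affine a b a0), (b (+) o e) => s es.
have qs u : inner e u -> on_arc q (affine (affine a b a0) (b (+) o e) u) (proj (away e u)).
  move=> eu; have := qP _ _ (on_arc_away eu); congr on_arc.
  by rewrite /a0 /affine; case: b {qP}; case: (o e); rewrite /= ?expr1 ?expr0; ring.
have [s0 sl] := es.
have [u su ul] : exists2 u, s < u & (u%:E < len e)%E.
  case: (len e) sl => [l||]//.
    rewrite lte_fin => sl; exists ((s + l) / 2); rewrite ?lte_fin; lra.
  by exists (s + 1); [lra|rewrite ltry].
have [h1 h2] := on_arc_range (qs u (conj (lt_trans s0 su) ul)).
have s2 : inner e (s / 2).
  split; first by lra.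
  by apply: lt_trans sl; rewrite lte_fin; lra.
have [h3 h4] := on_arc_range (qs _ s2).
have gt0 : 0 < affine (affine a b a0) (b (+) o e) s.
  move: h1 h3; set z := affine a b a0; rewrite /affine.
  by case: (b (+) o e); rewrite ?expr1 ?expr0; lra.
have ltl : ((affine (affine a b a0) (b (+) o e) s)%:E < len q)%E.
  case: (len q) h2 h4 => [l||]//; last by rewrite ltry.
  rewrite !lee_fin lte_fin; set z := affine a b a0; rewrite /affine.
  by case: (b (+) o e); rewrite ?expr1 ?expr0; lra.
by split => //; apply: on_arc_interior => //; exact: qs.
Qed.

Lemma proj_away_inj e e' s s' : inner e s -> inner e' s' ->
  proj (away e s) = proj (away e' s') -> e = e' /\ s = s'.
Proof.
move=> es es' /(spt_glue spt)[|]; first exact: away_inj.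
have [s0 sl] := inner_away es.
by move=> [v [v' [/ipt_neq_vertex]]]; case.
Qed.

Lemma packing_proj (I : choiceType) (r : seq I) (a : I -> garc T)
    (E : I -> set R) (B : set (gpoint Q)) :
  uniq r -> (forall i, measurable (E i)) ->
  (forall i s, i \in r -> E i s -> inner (a i) s /\ B (proj (away (a i) s))) ->
  (forall i j s, i \in r -> j \in r -> a i = a j -> E i s -> E j s -> i = j) ->
  (\sum_(i <- r) leb (E i) <= lambda B)%E.
Proof.
move=> ur mE EB Edisj.
have [q qP] := choice proj_away; have [c cP] := choice qP.
have [b bP] := choice cP.
apply: (@packing _ _ _ _ (q \o a) (c \o a) (b \o a)) => //=.
  move=> i s ri Es; have [es Bs] := EB _ _ ri Es; have [? ? pE] := bP _ _ es.
  by exists (proj (away (a i) s)) => //; rewrite pE; exact: on_arc_ipt.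
move=> i j s u ri rj Es Eu qij aff.
have [es _] := EB _ _ ri Es; have [eu _] := EB _ _ rj Eu.
have [_ _ pE] := bP _ _ es; have [_ _ pE'] := bP _ _ eu.
have [aij su] : a i = a j /\ s = u.
  by apply: proj_away_inj => //; rewrite pE pE' qij aff.
by subst u; apply: Edisj Eu.
Qed.

Lemma lambda_le_total_length (A : set (gpoint T)) :
  (lambda A <= total_length Q)%E.
Proof.
have mi e : measurable (inner e).
  apply: is_interval_measurable => s t [s0 _] [_ tl] u /andP[su ut].
  split; first exact: lt_le_trans su.
  by apply: le_lt_trans tl; rewrite lee_fin.
apply: (le_trans (lambda_le_away mi (fun e s => @proj1 _ _))).
apply: esum_le_sum => r ur.
by apply: (@packing_proj _ r id).
Qed.

End Away.

(** * The lower bound on the competitive ratio *)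

Section Hider.
Variables (R : realType) (Q : metric_graph R).
Implicit Types (S : R -> set (gpoint Q)) (H : gpoint Q).

Lemma search_time_ge0 S H : (0 <= search_time S H)%E.
Proof. by apply: le_ereal_inf_tmp => _ [t [t0 _ _] <-]; rewrite lee_fin. Qed.

Lemma norm_search_time_ge0 S H : (0 <= norm_search_time S H)%E.
Proof.
rewrite /norm_search_time; case: ifP => // _.
by rewrite mule_ge0 ?search_time_ge0// lee_fin invr_ge0 depth_ge0.
Qed.

Lemma search_timeE S H : 0 < depth H ->
  search_time S H = ((depth H)%:E * norm_search_time S H)%E.
Proof.
move=> H0; rewrite /norm_search_time; case: eqP => [HO|_].
  by rewrite HO depth_origin ltxx in H0.
by rewrite muleCA -EFinM divff ?gt_eqF// mule1.
Qed.

Lemma total_length_ge0 : (0 <= total_length Q)%E.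
Proof. by apply: esum_ge0 => e _; exact: measure_ge0. Qed.

(** If by any time [t] a search can have found only points of total weight at
most [t], each weight is found no earlier than the sum of the weights found
before it, and every pair of weights is counted in one of the two orders. *)
Lemma weighted_search_time (I : eqType) (r : seq I) (w : I -> R)
    (H : I -> gpoint Q) S :
  expanding_search S -> (forall i, i \in r -> 0 <= w i) ->
  (forall t (p : pred I), 0 <= t -> (t%:E <= total_length Q)%E ->
     (forall i, i \in r -> p i -> S t (H i)) ->
     \sum_(i <- r | p i) w i <= t) ->
  ((((\sum_(i <- r) w i) ^+ 2) / 2)%:E <=
    \sum_(i <- r) (w i)%:E * search_time S (H i))%E.
Proof.
move=> [_ Smono _ _] w0 wS; pose tau i := search_time S (H i).
have found i : i \in r ->
    ((\sum_(j <- r | (tau j <= tau i)%E) w j)%:E <= tau i)%E.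
  move=> ri; have := search_time_ge0 S (H i); rewrite -/(tau i).
  case tauE : (tau i) => [t||] // t0; last by rewrite leey.
  rewrite lee_fin; apply/ler_addgt0Pr => e e0.
  suff [u [u0 uQ ute uS]] : exists u, [/\ 0 <= u, (u%:E <= total_length Q)%E,
      u <= t + e & forall j, j \in r -> (tau j <= t%:E)%E -> S u (H j)].
    by apply: le_trans ute; apply: wS => // j rj; exact: uS.
  elim: {ri wS w0} r => [|j r [u [u0 uQ ute uS]]].
    exists 0; split => //; rewrite ?total_length_ge0//.
    by rewrite addr_ge0// ltW.
  have [jt|jt] := leP (tau j) t%:E; last first.
    exists u; split => // k; rewrite in_cons => /predU1P[->|]; last exact: uS.
    by rewrite leNgt jt.
  have /ereal_inf_lt[_ [v [v0 vQ vS] <-]] : (tau j < (t + e)%:E)%E.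
    by apply: (le_lt_trans jt); rewrite lte_fin ltrDl.
  rewrite lte_fin => /ltW vte.
  exists (Num.max u v); split => //.
  - by rewrite le_max u0.
  - by rewrite EFin_max ge_max uQ.
  - by rewrite ge_max ute.
  - have mQ : ((Num.max u v)%:E <= total_length Q)%E by rewrite EFin_max ge_max uQ.
    move=> k; rewrite in_cons => /predU1P[->|rk] kt.
      by apply: (Smono v) => //; rewrite le_max lexx orbT.
    by apply: (Smono u) => //; [rewrite le_max lexx|exact: uS].
apply: (@le_trans _ _
  (\sum_(i <- r) (w i * \sum_(j <- r | (tau j <= tau i)%E) w j)%:E)%E).
  rewrite sumEFin lee_fin ler_pdivrMr//.
  under [X in _ <= X * _]eq_bigr do rewrite mulr_sumr.
  rewrite mulr_natr mulr2n; set A := (X in _ <= X + _).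
  have AE : A = \sum_(i <- r) \sum_(j <- r | (tau i <= tau j)%E) w i * w j.
    rewrite /A (exchange_big_dep xpredT)//=.
    by apply: eq_bigr => i _; apply: eq_bigr => j _; rewrite mulrC.
  rewrite -/A {2}AE /A expr2 big_distrlr/= -big_split/=.
  rewrite big_seq [leRHS]big_seq; apply: ler_sum => i ri.
  rewrite [X in _ <= X + _]big_mkcond [X in _ <= _ + X]big_mkcond -big_split/=.
  rewrite big_seq [leRHS]big_seq; apply: ler_sum => j rj.
  have wij := mulr_ge0 (w0 _ ri) (w0 _ rj).
  case: ifP => [_|/negbT]; first by case: ifP => _; rewrite ?addr0// lerDl.
  by rewrite -ltNge => /ltW ->; rewrite add0r.
rewrite big_seq [leRHS]big_seq; apply: lee_sum => i ri.
by rewrite EFinM lee_wpmul2l ?lee_fin ?w0//; exact: found.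
Qed.

Lemma hider_bound (I : eqType) (r : seq I) (w : I -> R) (H : I -> gpoint Q)
    (rho0 : R) (d : measure_display) (Omega : measurableType d)
    (P : probability Omega R) (S : Omega -> R -> set (gpoint Q)) :
  randomized_search P S -> (rho_of P S <= rho0%:E)%E ->
  (forall i, i \in r -> 0 <= w i) -> (forall i, i \in r -> 0 < depth (H i)) ->
  (forall o t (p : pred I), 0 <= t -> (t%:E <= total_length Q)%E ->
     (forall i, i \in r -> p i -> S o t (H i)) ->
     \sum_(i <- r | p i) w i <= t) ->
  (\sum_(i <- r) w i) ^+ 2 / 2 <= rho0 * \sum_(i <- r) w i * depth (H i).
Proof.
move=> [eS mS] Srho w0 H0 wS; set Dw := (X in X <= _).
have wd0 i : i \in r -> 0 <= w i * depth (H i).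
  by move=> ri; rewrite mulr_ge0 ?w0 ?depth_ge0.
rewrite -lee_fin -[leLHS]mule1 -(@probability_setT _ _ _ P).
rewrite -integral_cst//.
pose wd i := if i \in r then w i * depth (H i) else 0.
have wdge0 i : 0 <= wd i by rewrite /wd; case: ifP => // /wd0.
apply: (@le_trans _ _
  (\int[P]_o \sum_(i <- r) (wd i)%:E * norm_search_time (S o) (H i))%E).
  apply: ge0_le_integral => //.
  - by move=> o _; rewrite lee_fin divr_ge0// sqr_ge0.
  - by apply: emeasurable_sum => i; exact: measurable_funeM.
  - move=> o _; apply: le_trans (weighted_search_time (eS o) w0 (wS o)) _.
    rewrite le_eqVlt; apply/orP; left; apply/eqP.
    rewrite big_seq [RHS]big_seq; apply: eq_bigr => i ri.
    by rewrite search_timeE ?H0// /wd ri EFinM muleA.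
rewrite ge0_integral_sum//; last 2 first.
- by move=> i; exact: measurable_funeM.
- by move=> i o _; rewrite mule_ge0 ?lee_fin ?norm_search_time_ge0.
rewrite mulr_sumr -sumEFin big_seq [leRHS]big_seq; apply: lee_sum => i ri.
rewrite ge0_integralZl//; last 2 first.
- by move=> o _; exact: norm_search_time_ge0.
- by rewrite lee_fin.
rewrite mulrC EFinM /wd ri lee_wpmul2l// ?lee_fin ?wd0//.
by apply: le_trans Srho; apply: ereal_sup_ubound; exists (H i).
Qed.

End Hider.

(** ** Hiding on a grid *)

Section GridSums.
Variable R : realType.

Lemma sum_grid (a b : R) n :
  \sum_(k <- iota 1 n) (a - k%:R * b) = n%:R * a - n%:R * n.+1%:R / 2 * b.
Proof.
elim: n => [|n IH]; first by rewrite big_nil !mul0r subr0.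
have -> : iota 1 n.+1 = iota 1 n ++ [:: n.+1] by rewrite -(addn1 n) iotaD (addnC 1).
by rewrite big_cat big_seq1 IH -(natr1 n.+1) -(natr1 n)/=; field.
Qed.

Lemma le_of_grids (G C : R) :
  (forall n, n%:R / n.+1%:R * G <= C) -> G <= C.
Proof.
move=> GC; rewrite leNgt; apply/negP => CG.
have C0 : 0 <= C by have := GC 0; rewrite !mul0r.
have [n] : exists n : nat, C / (G - C) < n%:R.
  exists (Num.truncn (C / (G - C))).+1; exact: truncnS_gt.
rewrite ltr_pdivrMr ?subr_gt0// => Cn.
have := GC n; rewrite mulrAC ler_pdivrMr ?ltr0n// -natr1 => h; nra.
Qed.

End GridSums.

Section ArcMass.
Variables (R : realType) (T : metric_graph R).
Variables (D : garc T -> R) (o : garc T -> bool).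
Hypothesis arc_depth : outward_depth D o.
Implicit Types (e : garc T) (x : R).

Definition pos_part x : R := Num.max 0 x.

(** The part of the excess of [x] over the depth [D e] that lies beyond [e]. *)
Definition overshoot e x : R :=
  if (len e < +oo)%E then pos_part (x - D e - fine (len e)) else 0.

(** The length of the part of an arc at depth less than [x]. *)
Definition arc_mass e x : R := pos_part (x - D e) - overshoot e x.

(** An antiderivative of [arc_mass e], which is also the integral of
[x - depth] over the part of the arc at depth less than [x]. *)
Definition arc_moment e x : R :=
  (pos_part (x - D e) ^+ 2 - overshoot e x ^+ 2) / 2.

Lemma pos_partP x : pos_part x = 0 /\ x <= 0 \/ pos_part x = x /\ 0 <= x.
Proof. by rewrite /pos_part; by case: (leP 0 x) => [h|/ltW h]; [right|left]. Qed.

Lemma arc_massP e x : D e < x ->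
  [/\ 0 < arc_mass e x, arc_mass e x <= x - D e,
      ((arc_mass e x)%:E <= len e)%E &
      arc_moment e x =
        (x - D e) * arc_mass e x - arc_mass e x ^+ 2 / 2].
Proof.
move=> Dx; rewrite /arc_mass /arc_moment /overshoot.
have -> : pos_part (x - D e) = x - D e by apply/max_idPr; lra.
have l0 := len_gt0 e.
case: ifPn => [el|]; last first.
  rewrite ltey negbK => /eqP->; split; [lra|lra|exact: leey|by field].
move: l0; rewrite -(fineK_len el) lte_fin lee_fin => l0.
by case: (pos_partP (x - D e - fine (len e))) => -[-> h];
  split; try lra; field.
Qed.

Lemma arc_mass_eq0 e x : x <= D e -> arc_mass e x = 0 /\ arc_moment e x = 0.
Proof.
move=> xD; rewrite /arc_mass /arc_moment /overshoot.
have -> : pos_part (x - D e) = 0 by apply/max_idPl; lra.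
case: ifPn => [el|_]; last by rewrite !expr2 mulr0 !subrr mul0r.
have l0 := len_gt0 e; rewrite -(fineK_len el) lte_fin in l0.
have -> : pos_part (x - D e - fine (len e)) = 0 by apply/max_idPl; lra.
by rewrite !expr2 mulr0 !subrr mul0r.
Qed.

Lemma arc_mass_ge0 e x : 0 <= arc_mass e x.
Proof.
by have [/arc_mass_eq0[->]|/arc_massP[/ltW]] := leP x (D e).
Qed.

Variables (Q : metric_graph R) (proj : gpoint T -> gpoint Q).
Hypotheses (cQ : connected_graph Q) (spt : shortest_path_tree proj).

Local Notation away := (away o).

(** A connected set containing the root reaches every point it has found on an
arc from one end of that arc.  So if it has found some of the points at
multiples of [delta e], it contains a whole cell of length [delta e] next to
each of them, on the side from which it comes, and these cells are disjoint. *)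
Lemma found_length (S0 : set (gpoint Q)) (delta : garc T -> R) (n : nat)
    (r : seq (garc T * nat)) :
  connected S0 -> S0 (origin Q) -> uniq r ->
  (forall i, i \in r -> [/\ 0 < delta i.1, (0 < i.2 <= n)%N,
     ((n.+1%:R * delta i.1)%:E <= len i.1)%E &
     S0 (proj (away i.1 (i.2%:R * delta i.1)))]) ->
  ((\sum_(i <- r) delta i.1)%:E <= lambda S0)%E.
Proof.
move=> cS SO ur rP.
pose reached_below (i : garc T * nat) :=
  forall s, 0 < s <= i.2%:R * delta i.1 -> S0 (proj (away i.1 s)).
(* Cell [k] lies between the points [k] and [k.+1] of the grid. *)
pose cell (i : garc T * nat) := if `[< reached_below i >] then i.2.-1 else i.2.
pose E i : set R := [set` `]((cell i)%:R * delta i.1), ((cell i).+1%:R * delta i.1)[].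
have cellP i : i \in r -> (cell i <= n)%N.
  by move=> /rP[_ /andP[_ kn] _ _]; rewrite /cell; case: ifP => _ //;
    rewrite (leq_trans _ kn)// leq_pred.
have innerE i s : i \in r -> E i s -> inner i.1 s.
  move=> ri; have [d0 _ dl _] := rP _ ri; rewrite /E/= in_itv/= => /andP[s1 s2].
  split; first by apply: le_lt_trans s1; rewrite mulr_ge0// ltW.
  apply: lt_le_trans dl; rewrite lte_fin; apply: (lt_le_trans s2).
  by rewrite ler_pM2r// ler_nat ltnS cellP.
have inner_pt i : i \in r -> inner i.1 (i.2%:R * delta i.1).
  move=> ri; have [d0 /andP[k0 kn] dl _] := rP _ ri.
  split; first by rewrite mulr_gt0// ltr0n.
  by apply: lt_le_trans dl; rewrite lte_fin ltr_pM2r// ltr_nat.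
apply: (@le_trans _ _ (\sum_(i <- r) lebesgue_measure (E i))%E).
  rewrite -sumEFin big_seq [leRHS]big_seq; apply: lee_sum => i ri.
  have [d0 _ _ _] := rP _ ri.
  rewrite /E lebesgue_measure_itv/= lte_fin ltr_pM2r// ltr_nat leqnn.
  by rewrite -EFinB lee_fin -natr1; lra.
apply: (packing_proj arc_depth spt (a := fst)) => //.
- by move=> i; exact: measurable_itv.
- move=> i s ri Es; split; first exact: innerE.
  have [d0 /andP[k0 kn] dl St] := rP _ ri.
  move: Es; rewrite /E/= in_itv/= /cell; case: asboolP => [below|nbelow].
    move=> /andP[s1 s2]; apply: below; rewrite prednK// in s2.
    rewrite (ltW s2) andbT; apply: le_lt_trans s1.
    by rewrite mulr_ge0// ltW.
  move=> /andP[s1 s2].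
  have [q [c [b qP]]] := proj_away arc_depth spt i.1.
  have [t0 tl tE] := qP _ (inner_pt _ ri).
  have es := innerE _ s ri; rewrite /E/= in_itv/= /cell in es.
  have {}es : inner i.1 s by apply: es; case: asboolP => //; rewrite s1 s2.
  have [s0 sl sE] := qP _ es.
  rewrite tE in St; rewrite sE.
  have [side|side] := connected_arc_side cQ cS SO t0 tl St.
    case: b {St sE t0 tl tE} qP s0 sl side => qP s0 sl side.
      by apply: side; rewrite s0 /affine expr1; lra.
    case: nbelow => u /andP[u0 us]; have eu : inner i.1 u.
      split => //; have [_] := inner_pt _ ri; apply: le_lt_trans.
      by rewrite lee_fin.
    have [u1 u2 ->] := qP _ eu; apply: side; rewrite u1 /affine expr0; lra.
  case: b {St sE t0 tl tE} qP s0 sl side => qP s0 sl side.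
    case: nbelow => u /andP[u0 us]; have eu : inner i.1 u.
      split => //; have [_] := inner_pt _ ri; apply: le_lt_trans.
      by rewrite lee_fin.
    have [u1 u2 ->] := qP _ eu; apply: side => //; rewrite /affine expr1; lra.
  by apply: side => //; rewrite /affine expr0; lra.
- have below_le e k l : (e, k) \in r -> (e, l) \in r -> (k <= l)%N ->
      reached_below (e, l) -> reached_below (e, k).
    move=> /rP[/= d0 _ _ _] _ kl lS s /= /andP[s0 sk]; apply: lS => /=.
    by rewrite s0 (le_trans sk)// ler_pM2r// ler_nat.
  have wlog_lt e k l s : (e, k) \in r -> (e, l) \in r -> (k < l)%N ->
      E (e, k) s -> E (e, l) s -> False.
    move=> rk rl kl; have [/= d0 _ _ _] := rP _ rk.
    rewrite /E/= !in_itv/= => /andP[k1 k2] /andP[l1 l2].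
    have : (cell (e, l) < (cell (e, k)).+1)%N.
      by rewrite -(ltr_nat R) -(ltr_pM2r d0) (lt_trans l1).
    rewrite /cell/=; case: asboolP => [bl|bl]; case: asboolP => bk.
    + have [_ /andP[/= k0 _] _ _] := rP _ rk.
      by rewrite !prednK ?(leq_trans _ kl)// leqNgt kl.
    + by case: bk; apply: below_le bl => //; exact: ltnW.
    + have [_ /andP[/= k0 _] _ _] := rP _ rk.
      by rewrite prednK// ltnNge (ltnW kl).
    + by rewrite ltnNge kl.
  move=> [e k] [e' l] s rk rl /= ee; subst e' => Ek El.
  by have [kl|lk|->//] := ltngtP k l; [case: (wlog_lt e k l s)|case: (wlog_lt e l k s)].
Qed.

(** The Hider chooses an arc in proportion to the length it has at depth less
than [x], then one of [n] equally spaced points of that part.  No expanding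
search finds points faster than at unit speed, so the mean depth of the hiding
place cannot be too small compared with the competitive ratio. *)
Lemma grid_bound (rho0 x : R) (d : measure_display) (Omega : measurableType d)
    (P : probability Omega R) (S : Omega -> R -> set (gpoint Q))
    (F : seq (garc T)) (n : nat) :
  randomized_search P S -> (rho_of P S <= rho0%:E)%E -> uniq F -> 0 < x ->
  n%:R / n.+1%:R * (\sum_(e <- F) arc_moment e x) <= rho0 * x ^+ 2 / 2.
Proof.
move=> rS Srho uF x0.
rewrite (bigID (fun e => D e < x))/= [X in _ * (_ + X)]big1 ?addr0; last first.
  by move=> e; rewrite -leNgt => /arc_mass_eq0[].
rewrite -big_filter; set F' := [seq e <- F | D e < x].
have uF' : uniq F' by exact: filter_uniq.
have DF' e : e \in F' -> D e < x by rewrite mem_filter => /andP[].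
pose delta e : R := arc_mass e x / n.+1%:R.
have deltaE e : n.+1%:R * delta e = arc_mass e x.
  by rewrite mulrC divfK// pnatr_eq0.
pose r := [seq (e, k) | e <- F', k <- iota 1 n].
have ur : uniq r by apply: allpairs_uniq => //; [exact: iota_uniq|case=> ? ? []].
have rP i : i \in r -> [/\ 0 < delta i.1, (0 < i.2 <= n)%N,
     ((n.+1%:R * delta i.1)%:E <= len i.1)%E & D i.1 < x].
  case/allpairsP => -[e k] /= [eF]; rewrite mem_iota add1n ltnS => kn ->/=.
  have [m0 _ ml _] := arc_massP (DF' _ eF).
  by split; rewrite ?deltaE ?DF'// divr_gt0 ?ltr0n.
pose H (i : garc T * nat) := proj (away i.1 (i.2%:R * delta i.1)).
have inn i : i \in r -> inner i.1 (i.2%:R * delta i.1).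
  move=> /rP[d0 /andP[k0 kn] dl _].
  split; first by rewrite mulr_gt0// ltr0n.
  by apply: lt_le_trans dl; rewrite lte_fin ltr_pM2r// ltr_nat.
have depthH i : i \in r -> depth (H i) = D i.1 + i.2%:R * delta i.1.
  move=> ri; rewrite -(spt_depth spt) (depth_away arc_depth)//; exact: inn.
have -> : n%:R / n.+1%:R * \sum_(i <- F') arc_moment i x =
    \sum_(i <- r) delta i.1 * (x - depth (H i)).
  rewrite [RHS]big_seq; under [RHS]eq_bigr => i ri do rewrite depthH//.
  rewrite -big_seq /r big_allpairs_dep mulr_sumr big_seq [RHS]big_seq.
  apply: eq_bigr => e /DF' /arc_massP[_ _ _ ->].
  rewrite /= -mulr_sumr; under eq_bigr do rewrite opprD addrA.
  (* On this grid the sum for a linear function is [n / n.+1] times its integral. *)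
  rewrite sum_grid -deltaE -natr1; have : (n%:R + 1 : R) != 0 by rewrite natr1 pnatr_eq0.
  by move=> ?; field.
set W := \sum_(i <- r) delta i.1; set M := \sum_(i <- r) delta i.1 * depth (H i).
have -> : \sum_(i <- r) delta i.1 * (x - depth (H i)) = x * W - M.
  by rewrite mulr_sumr -sumrB; apply: eq_bigr => i _; rewrite mulrBr mulrC.
have WM : W ^+ 2 / 2 <= rho0 * M.
  apply: (hider_bound (w := fun i => delta i.1) rS Srho).
  - by move=> i /rP[/ltW].
  - move=> i ri; rewrite depthH//; have [D0 _ _] := arc_depth i.1.
    by have [s0 _] := inn _ ri; rewrite ltr_wpDl.
  - move=> w t p t0 tQ St; rewrite -big_filter -lee_fin.
    have [S0 Smono Sconn Sl] := rS.1 w.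
    rewrite -(Sl t t0 tQ); apply: (found_length (n := n)); first exact: Sconn.
    + by apply: (Smono 0) => //; rewrite S0.
    + exact: filter_uniq.
    + move=> i; rewrite mem_filter => /andP[pi ri].
      by have [? ? ? _] := rP _ ri; split => //; exact: St.
have W0 : 0 <= W by rewrite /W big_seq; apply: sumr_ge0 => i /rP[/ltW].
have M0 : 0 <= M.
  by rewrite /M big_seq; apply: sumr_ge0 => i /rP[/ltW d0 _ _ _];
    rewrite mulr_ge0 ?depth_ge0.
have rho0_ge0 : 0 <= rho0.
  rewrite -lee_fin; apply: le_trans Srho; apply: le_trans (ereal_sup_ubound _).
    by apply: (integral_ge0 P (f := fun w => norm_search_time (S w) (origin Q)));
      move=> w _; exact: norm_search_time_ge0.
  by exists (origin Q).
have [rho00|rho0n0] := eqVneq rho0 0.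
  have -> : W = 0 by move: WM; rewrite rho00 => h; nra.
  by rewrite rho00; lra.
have rho0_gt0 : 0 < rho0 by rewrite lt_neqAle eq_sym rho0n0.
rewrite -(ler_pM2l rho0_gt0).
(* The inequality between the means of [W] and [rho0 * x]. *)
have := sqr_ge0 (W - rho0 * x); nra.
Qed.

(** The left side is the integral from 0 to [x] of the length that the arcs of
[F] have at depth less than the variable of integration. *)
Lemma moment_bound (rho0 x : R) (d : measure_display) (Omega : measurableType d)
    (P : probability Omega R) (S : Omega -> R -> set (gpoint Q))
    (F : seq (garc T)) :
  randomized_search P S -> (rho_of P S <= rho0%:E)%E -> uniq F -> 0 < x ->
  \sum_(e <- F) arc_moment e x <= rho0 * x ^+ 2 / 2.
Proof.
by move=> rS Srho uF x0; apply: le_of_grids => n; exact: grid_bound rS Srho uF x0.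
Qed.

End ArcMass.

(** * Depth-first search of a stratum *)

Section Strata.
Variables (R : realType) (T : metric_graph R).
Variables (D : garc T -> R) (o : garc T -> bool).
Hypothesis arc_depth : outward_depth D o.
Hypothesis cT : connected_graph T.
Implicit Types (e : garc T) (x y z : gpoint T) (a b s t : R).
Local Notation away := (away o).
Local Notation trace := (trace o).
Local Notation leb := (@lebesgue_measure R).

Lemma arc_mass_moment e (x : R) : 0 <= x ->
  x * arc_mass D e x <= arc_moment D e (2 * x).
Proof.
move=> x0; have [/arc_mass_eq0[-> _]|Dx] := leP x (D e).
  rewrite mulr0; have [/arc_mass_eq0[_ -> //]|/arc_massP[m0 mx _ ->]] := leP (2 * x) (D e).
  nra.
have [m0 mx ml _] := arc_massP Dx.
have [|m0' mx' ml' ->] := @arc_massP _ _ D e (2 * x); first by lra.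
have mm : arc_mass D e x <= arc_mass D e (2 * x).
  rewrite /arc_mass /overshoot; case: ifP => _.
    by case: (pos_partP (x - D e)) => -[-> ?]; case: (pos_partP (2 * x - D e)) => -[-> ?];
    case: (pos_partP (x - D e - fine (len e))) => -[-> ?]; case: (pos_partP (2 * x - D e - fine (len e))) => -[-> ?]; lra.
  by case: (pos_partP (x - D e)) => -[-> ?]; case: (pos_partP (2 * x - D e)) => -[-> ?]; lra.
nra.
Qed.

Lemma arc_mass_le e (x x' : R) : x <= x' -> arc_mass D e x <= arc_mass D e x'.
Proof.
move=> xx'; have l0 : 0 <= fine (len e) by rewrite fine_ge0// ltW// len_gt0.
rewrite /arc_mass /overshoot; case: ifP => _.
  by case: (pos_partP (x - D e)) => -[-> ?]; case: (pos_partP (x' - D e)) => -[-> ?];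
  case: (pos_partP (x - D e - fine (len e))) => -[-> ?]; case: (pos_partP (x' - D e - fine (len e))) => -[-> ?]; lra.
by case: (pos_partP (x - D e)) => -[-> ?]; case: (pos_partP (x' - D e)) => -[-> ?]; lra.
Qed.

Lemma inner_between e s t u : inner e s -> inner e t -> s <= u <= t -> inner e u.
Proof.
move=> [s0 _] [_ tl] /andP[su ut]; split; first exact: lt_le_trans su.
by apply: le_lt_trans tl; rewrite lee_fin.
Qed.

Lemma interval_trace (A : set (gpoint T)) e :
  (forall s t u, inner e s -> inner e t -> s <= u <= t ->
     A (away e s) -> A (away e t) -> A (away e u)) ->
  measurable (trace A e).
Proof.
move=> Ai; apply: is_interval_measurable => s t [es As] [et At] u sut.
by split; [exact: inner_between sut|exact: Ai sut As At].
Qed.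

Definition below (x : R) : set (gpoint T) := [set z | depth z < x].

Lemma measurable_trace_below (x : R) e : measurable (trace (below x) e).
Proof.
apply: interval_trace => s t u es et sut _; have eu := inner_between es et sut.
rewrite /below/= !(depth_away arc_depth)//; apply: le_lt_trans.
by case/andP: sut => _ ut; rewrite lerD2l.
Qed.

Lemma measurable_trace_stratum a b e : measurable (trace (stratum a b) e).
Proof.
apply: interval_trace => s t u es et sut; have eu := inner_between es et sut.
rewrite /stratum/= !(depth_away arc_depth)//.
case/andP: sut => su ut /andP[h1 _] /andP[_ h2]; apply/andP; split; lra.
Qed.

Lemma lebesgue_trace_below (x : R) e :
  leb (trace (below x) e) = (arc_mass D e x)%:E.
Proof.
have [xD|Dx] := leP x (D e).
  have [-> _] := arc_mass_eq0 xD; rewrite (_ : trace _ _ = set0) ?measure0//.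
  apply/seteqP; split => // s [es]; rewrite /below/= (depth_away arc_depth)//.
  by case: es => s0 _; lra.
have [m0 _ _ _] := arc_massP Dx.
rewrite (_ : trace _ _ = [set` `]0, arc_mass D e x[]); last first.
  apply/seteqP; split => s; rewrite /= in_itv/=.
    case=> -[s0 sl]; rewrite /below/= (depth_away arc_depth)// s0/=.
    rewrite /arc_mass /overshoot; have -> : pos_part (x - D e) = x - D e by apply/max_idPr; lra.
    case: ifPn => [el|_]; last by lra.
    move: sl; rewrite -(fineK_len el) lte_fin.
    by case: (pos_partP (x - D e - fine (len e))) => -[-> ?]; lra.
  move=> /andP[s0 sm].
  have [_ mx ml _] := arc_massP Dx.
  have es : inner e s by split => //; apply: lt_le_trans ml; rewrite lte_fin.
  by split => //; rewrite /below/= (depth_away arc_depth)//; lra.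
by rewrite lebesgue_measure_itv/= lte_fin m0 sube0.
Qed.

Lemma lambda_below (x : R) :
  lambda (below x) = (\esum_(e in setT) (arc_mass D e x)%:E)%E.
Proof.
rewrite (lambda_away arc_depth); last by move=> e; exact: measurable_trace_below.
by apply: eq_esum => e _; exact: lebesgue_trace_below.
Qed.

Lemma lambda_belowD a b : a <= b ->
  (lambda (below a) + lambda (stratum a b : set (gpoint T)) = lambda (below b))%E.
Proof.
move=> ab; rewrite !(lambda_away arc_depth) -?esumD; last 5 first.
- by move=> e _; exact: measure_ge0.
- by move=> e _; exact: measure_ge0.
- by move=> e; exact: measurable_trace_below.
- by move=> e; exact: measurable_trace_stratum.
- by move=> e; exact: measurable_trace_below.
apply: eq_esum => e _; rewrite -measureU.
- congr leb; apply/seteqP; split => s.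
    case=> -[es h]; split => //; move: h; rewrite /below /stratum/=; first by lra.
    by case/andP.
  move=> [es h]; have [sa|sa] := ltP (depth (away e s)) a; [left|right]; split => //.
  by rewrite /stratum/= sa.
- exact: measurable_trace_below.
- exact: measurable_trace_stratum.
- apply/seteqP; split => // s [[_ +] [_]]; rewrite /below /stratum/= => h1 /andP[h2 _].
  by lra.
Qed.

Lemma ancestor_away e s t : inner e s -> inner e t -> s <= t ->
  ancestor (away e s) (away e t).
Proof.
move=> es et st; rewrite /ancestor !(depth_away arc_depth)//.
apply/eqP; rewrite eq_le; apply/andP; split.
  have := gdist_triangle cT (origin T) (away e s) (away e t).
  by rewrite -!/(depth _) !(depth_away arc_depth).
have := joined_arc (on_arc_away arc_depth es) (on_arc_away arc_depth et).
move=> /gdist_le; have -> : `|affine (if o e then fine (len e) else 0) (o e) t -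
    affine (if o e then fine (len e) else 0) (o e) s| = t - s.
  rewrite /affine; case: (o e); rewrite ?expr1 ?expr0.
    by rewrite distrC (_ : _ - _ = t - s) ?ger0_norm ?subr_ge0//; ring.
  by rewrite (_ : _ - _ = t - s) ?ger0_norm ?subr_ge0//; ring.
lra.
Qed.

Lemma ancestor_trans x y z : ancestor x y -> ancestor y z -> ancestor x z.
Proof.
rewrite /ancestor => xy yz; have := gdist_triangle cT x y z.
have := gdist_triangle cT (origin T) x z; rewrite -!/(depth _); lra.
Qed.

Variables (a b : R) (L : gpoint T -> gpoint T -> Prop) (y : gpoint T).
Hypotheses (dfsL : dfs_order (stratum a b) L) (Wy : stratum a b y).
Local Notation W := (stratum a b : set (gpoint T)).

Definition visited : set (gpoint T) := [set z | W z /\ L z y].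
Definition ancestors : set (gpoint T) := [set z | W z /\ ancestor z y].

Lemma stratum_between e s t u : inner e s -> inner e t -> s <= u <= t ->
  W (away e s) -> W (away e t) -> W (away e u).
Proof.
move=> es et sut Ws Wt; have [] : trace W e u => //.
move: sut Ws Wt; rewrite /stratum/= => sut.
have eu := inner_between es et sut; split => //.
move: Ws Wt; rewrite /= !(depth_away arc_depth)//; lra.
Qed.

(** On an arc, what a depth-first search visits before [y] is an initial
segment of its part of the stratum. *)
Lemma measurable_trace_visited e : measurable (trace visited e).
Proof.
apply: interval_trace => s t u es et sut [Ws _] [Wt Lt].
have eu := inner_between es et sut; have Wu := stratum_between es et sut Ws Wt.
split => //; have [ut|tu] := ltP u t; last first.
  by have -> : u = t by apply/eqP; rewrite eq_le tu andbT; case/andP: sut.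
apply: (dfs_trans dfsL) Lt => //; apply: (dfs_ancestor dfsL) => //.
  by apply: ancestor_away => //; exact: ltW.
by move=> /(away_inj arc_depth eu et)[_ ut']; rewrite ut' ltxx in ut.
Qed.

Lemma measurable_trace_ancestors e : measurable (trace ancestors e).
Proof.
apply: interval_trace => s t u es et sut [Ws _] [Wt At].
have eu := inner_between es et sut; split; first exact: stratum_between sut Ws Wt.
by apply: ancestor_trans At; apply: ancestor_away => //; case/andP: sut.
Qed.

(** Of two points of the stratum at the same depth, the one visited first
cannot be an ancestor of [y] unless the other is its descendant, at distance
zero. *)
Lemma ancestors_depth_inj e e' s s' : inner e s -> inner e' s' ->
  ancestors (away e s) -> ancestors (away e' s') ->
  D e + s = D e' + s' -> away e s = away e' s'.
Proof.
wlog Lz : e e' s s' / L (away e s) (away e' s').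
  move=> wl es es' As As' ss'; apply: contrapT => zz'.
  have [Lz|Lz] := dfs_total dfsL As.1 As'.1 zz'; first exact/zz'/wl.
  by apply: zz'; apply/esym/wl.
move=> es es' [Ws As] [Ws' As'].
rewrite -!(depth_away arc_depth)// => dd.
have dist0 z : gdist (away e s) z = 0 -> z = away e s.
  by have [? ?] := inner_away arc_depth es; exact: gdist0_ipt.
apply/esym/dist0; have [y'|y'] := pselect (away e' s' = y).
  by move: As; rewrite /ancestor y' -y' -dd; lra.
have Ly : L (away e' s') y by apply: (dfs_ancestor dfsL).
have := dfs_subtree dfsL Ws Wy Ws' As Lz Ly.
by rewrite /ancestor -dd; lra.
Qed.

Lemma lambda_ancestors : (lambda ancestors <= (depth y - a)%:E)%E.
Proof.
rewrite (lambda_away arc_depth); last exact: measurable_trace_ancestors.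
have ay : a <= depth y by case/andP: Wy.
have -> : (depth y - a)%:E =
    (\esum_(k in [set: unit]) leb [set` `[a, depth y]])%E.
  rewrite (_ : [set: unit] = [set tt]); last by apply/seteqP; split => -[].
  rewrite esum_set1// lebesgue_measure_itv/= lte_fin.
  have [_|ya] := ltP a (depth y); first by rewrite EFinB.
  by have -> : depth y - a = 0 by lra.
apply: esum_le_sum => r ur.
apply: (@packing _ _ _ r (fun=> tt) D (fun=> false)) => //.
- exact: measurable_trace_ancestors.
- move=> e s _ [es [Ws As]]; rewrite /affine expr0 mul1r /= in_itv/=.
  rewrite -(depth_away arc_depth)//; case/andP: Ws => -> _ /=.
  by rewrite As lerDl gdist_ge0.
- move=> e e' s s' _ _ [es As] [es' As'] _; rewrite /affine expr0 !mul1r => ss'.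
  by have [] := away_inj arc_depth es es' (ancestors_depth_inj es es' As As' ss').
Qed.

Lemma not_visited z : W z -> L y z -> ~ L z y.
Proof.
by move=> Wz yz zy; exact: (dfs_irr dfsL Wy) (dfs_trans dfsL Wy Wz Wy yz zy).
Qed.

(** Apart from the ancestors of [y], no point is visited before [y] both by a
depth-first search and by the reverse one. *)
Lemma visit_time_rev :
  (visit_time W L y + visit_time W (dfs_rev L) y <=
   lambda W + (depth y - a)%:E)%E.
Proof.
pose N : set (gpoint T) := [set z | W z /\ ~ L z y].
have traceN e : trace N e = trace W e `\` trace visited e.
  apply/seteqP; split => s; first by move=> [es [Ws nL]]; split => // -[_ []].
  by move=> [[es Ws] nv]; do 2!split => //; move=> Ls; apply: nv.
have mN e : measurable (trace N e).
  rewrite traceN; apply: measurableD; first exact: measurable_trace_stratum.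
  exact: measurable_trace_visited.
have mA := measurable_trace_ancestors.
have revle : (visit_time W (dfs_rev L) y <= lambda N + lambda ancestors)%E.
  rewrite [X in (_ <= X + _)%E](lambda_away arc_depth)//.
  rewrite [X in (_ <= _ + X)%E](lambda_away arc_depth)//.
  rewrite -esumD; last 2 first.
  - by move=> e _; exact: measure_ge0.
  - by move=> e _; exact: measure_ge0.
  apply: (@le_trans _ _ (\esum_(e in setT) leb (trace N e `|` trace ancestors e))%E).
    apply: (lambda_le_away arc_depth) => e; first exact: measurableU.
    move=> s [es [Ws]] [[As _]|[_ _ yL]]; [right|left]; do 2!split => //.
    exact: not_visited.
  apply: le_esum => e _.
  exact: (measureU2 (@lebesgue_measure R) (mN e) (mA e)).
have WE : (lambda W = visit_time W L y + lambda N)%E.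
  rewrite /visit_time -/visited !(lambda_away arc_depth)//; last 2 first.
  - exact: measurable_trace_visited.
  - by move=> e; exact: measurable_trace_stratum.
  rewrite -esumD; last 2 first.
  - by move=> e _; exact: measure_ge0.
  - by move=> e _; exact: measure_ge0.
  apply: eq_esum => e _; rewrite traceN -measureU.
  - congr leb; apply/seteqP; split => s.
      by move=> Ws; have [?|?] := pselect (trace visited e s); [left|right].
    by case=> [[es [Ws _]]|[]//]; split.
  - exact: measurable_trace_visited.
  - by rewrite -traceN; exact: mN.
  - by apply/seteqP; split => // s [tv [_ ntv]]; exact: ntv.
rewrite WE -addeA; apply: leeD => //.
by apply: (le_trans revle); apply: leeD => //; exact: lambda_ancestors.
Qed.

End Strata.

(** * Integrals against uniform distributions *)

Section QuadraticEstimate.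
Variable R : realType.
Local Notation leb := (@lebesgue_measure R).
Variables (K k : R -> R) (C : R).
Hypothesis est : forall x y, `|K y - K x - (y - x) * k x| <= C * (y - x) ^+ 2.

Lemma estimate_ge0 : 0 <= C.
Proof.
have := est 0 1; rewrite subr0 expr1n mulr1; exact/le_trans/normr_ge0.
Qed.

Lemma estimate_lipschitz x y : `|k y - k x| <= 2 * C * `|y - x|.
Proof.
have [->|xy] := eqVneq y x; first by rewrite !subrr !normr0 mulr0.
have yx0 : 0 < `|y - x| by rewrite normr_gt0 subr_eq0.
rewrite -(ler_pM2r yx0) -normrM.
have -> : 2 * C * `|y - x| * `|y - x| = 2 * C * (y - x) ^+ 2.
  by rewrite -mulrA -normrM -expr2 ger0_norm ?sqr_ge0.
have h1 := est x y; have := est y x; rewrite -[X in C * X]sqrrN opprB => h2.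
apply: le_trans (_ : `|(K y - K x - (y - x) * k x) + (K x - K y - (x - y) * k y)| <= _).
  by rewrite le_eqVlt; apply/orP; left; apply/eqP; congr `|_|; ring.
by apply: (le_trans (ler_normD _ _)); lra.
Qed.

Lemma estimate_continuous : continuous k.
Proof.
move=> x; apply/cvgrPdist_le => e e0 /=.
have C0 := estimate_ge0; have d0 : 0 < e / (2 * C + 1) by rewrite divr_gt0//; lra.
have near_d : \forall y \near x, `|x - y| <= e / (2 * C + 1).
  have /cvgrPdist_le : (fun y : R => y) @ x --> x by exact: cvg_id.
  exact.
near=> y; rewrite distrC; apply: (le_trans (estimate_lipschitz _ _)).
have : `|x - y| <= e / (2 * C + 1) by near: y; exact: near_d.
rewrite distrC ler_pdivlMr; last lra.
have := normr_ge0 (y - x); nra.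
Unshelve. all: by end_near. Qed.

Lemma estimate_cvg x :
  (fun h => h^-1 *: ((K \o shift x) (h *: 1) - K x)) @ 0^' --> k x.
Proof.
apply/cvgrPdist_le => e e0 /=.
have C0 := estimate_ge0; have d0 : 0 < e / (C + 1) by rewrite divr_gt0//; lra.
near=> h.
have h0 : h != 0 by near: h; exact: nbhs_dnbhs_neq.
have hd : `|h| < e / (C + 1) by near: h; exact: dnbhs0_lt.
rewrite distrC /= /GRing.scale/= mulr1.
have -> : h^-1 * (K (h + x) - K x) - k x =
    h^-1 * (K (x + h) - K x - (x + h - x) * k x).
  by rewrite (addrC h); field.
rewrite normrM normfV mulrC ler_pdivrMr ?normr_gt0//.
apply: (le_trans (est _ _)); rewrite addrAC subrr add0r.
rewrite -real_normK ?num_real// ltr_pdivlMr in hd *; last lra.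
have := normr_ge0 h; nra.
Unshelve. all: by end_near. Qed.

(** The estimate says that [k] is the derivative of [K] and that it is Lipschitz;
it can be checked for sums of arcs without discussing the depths at which an
arc begins or ends. *)
Lemma estimate_integral u v : u <= v ->
  (\int[leb]_(x in `[u, v]) (k x)%:E = (K v - K u)%:E)%E.
Proof.
rewrite le_eqVlt => /predU1P[->|uv].
  by rewrite set_itv1 integral_set1 subrr.
have dK x : derivable K x 1 by apply/cvg_ex; exists (k x); exact: estimate_cvg.
have cK : continuous K.
  by move=> x; apply: differentiable_continuous; exact/derivable1_diffP.
rewrite EFinB; apply: continuous_FTC2 => //.
- by apply: continuous_subspaceT; exact: estimate_continuous.
- split; first by move=> x _; exact: dK.
  + by apply: cvg_at_right_filter; exact: cK.
  + by apply: cvg_at_left_filter; exact: cK.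
- move=> x _; rewrite derive1E; apply: cvg_lim => //; exact: estimate_cvg.
Qed.

Lemma uniform_integral (p q : R) (pq : p < q) u v :
  (forall x, 0 <= k x) -> p <= u -> u <= v -> v <= q ->
  (\int[uniform_prob pq]_x ((EFin \o k) \_ `[u, v]) x =
   ((K v - K u) / (q - p))%:E)%E.
Proof.
move=> k0 pu uv vq; rewrite integral_uniform; last 2 first.
- apply/(measurable_restrictT _ _).1 => //; apply/measurable_EFinP.
  by apply: measurable_funTS; apply: continuous_measurable_fun; exact: estimate_continuous.
- by apply: erestrict_ge0 => x _; rewrite lee_fin.
rewrite -integral_mkcondr setIidr ?estimate_integral// -?EFinM 1?mulrC//.
by move=> x; rewrite /= !in_itv/= => /andP[? ?]; apply/andP; split; lra.
Qed.

End QuadraticEstimate.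

(** * The length at small depth *)

Section ArcMoments.
Variables (R : realType) (T : metric_graph R) (D : garc T -> R).
Implicit Types (F : seq (garc T)) (e : garc T).

Definition mass F (x : R) := \sum_(e <- F) arc_mass D e x.
Definition moment F (x : R) := \sum_(e <- F) arc_moment D e x.

Lemma mass_ge0 F x : 0 <= mass F x.
Proof. by apply: sumr_ge0 => e _; exact: arc_mass_ge0. Qed.

Lemma pos_part_estimate (x y : R) :
  0 <= (pos_part y ^+ 2 - pos_part x ^+ 2) / 2 - (y - x) * pos_part x <=
  (y - x) ^+ 2 / 2.
Proof.
have h1 := sqr_ge0 x; have h2 := sqr_ge0 y; have h3 := sqr_ge0 (y - x).
case: (pos_partP x) => -[-> x0]; case: (pos_partP y) => -[-> y0];
  apply/andP; split; try lra.
- have := mulr_ge0_le0 y0 x0; lra.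
- have := mulr_ge0_le0 x0 y0; lra.
Qed.

Lemma arc_moment_estimate e (x y : R) :
  `|arc_moment D e y - arc_moment D e x - (y - x) * arc_mass D e x|
    <= (y - x) ^+ 2.
Proof.
have /andP[] := pos_part_estimate (x - D e) (y - D e).
have -> : y - D e - (x - D e) = y - x by ring.
rewrite /arc_moment /arc_mass /overshoot; case: ifP => _; last first.
  by move=> h1 h2; rewrite ler_norml; apply/andP; split; nra.
have /andP[] := pos_part_estimate (x - D e - fine (len e)) (y - D e - fine (len e)).
have -> : y - D e - fine (len e) - (x - D e - fine (len e)) = y - x by ring.
set a := pos_part (x - D e); set b := pos_part (y - D e).
set a' := pos_part (x - D e - _); set b' := pos_part (y - D e - _).
by move=> h1 h2 h3 h4; rewrite ler_norml; apply/andP; split; lra.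
Qed.

Lemma moment_estimate F (x y : R) :
  `|moment F y - moment F x - (y - x) * mass F x| <= (size F)%:R * (y - x) ^+ 2.
Proof.
rewrite /moment /mass mulr_sumr -!sumrB; apply: (le_trans (ler_norm_sum _ _ _)).
have -> : (size F)%:R * (y - x) ^+ 2 = \sum_(e <- F) (y - x) ^+ 2.
  by rewrite big_const_seq count_predT iter_addr_0 mulr_natl.
apply: ler_sum => e _; exact: arc_moment_estimate.
Qed.

Lemma moment_ge0 F x : 0 <= moment F x.
Proof.
apply: sumr_ge0 => e _; have [/arc_mass_eq0[_ ->//]|/arc_massP[m0 mx _ ->]] := leP x (D e).
nra.
Qed.

End ArcMoments.

Section Balls.
Variables (R : realType) (T : metric_graph R).
Variables (D : garc T -> R) (o : garc T -> bool).
Hypothesis arc_depth : outward_depth D o.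
Variable rho0 : R.
Hypothesis momentP : forall (F : seq (garc T)) x, uniq F -> 0 < x ->
  moment D F x <= rho0 * x ^+ 2 / 2.
Local Notation below := (@below R T).

Lemma lambda_below_fin (x : R) : 0 < x -> lambda (below x) \is a fin_num.
Proof.
move=> x0; have xrho : (lambda (below x) <= (2 * rho0 * x)%:E)%E.
  rewrite (lambda_below arc_depth); apply: esum_le_sum => F uF.
  rewrite sumEFin lee_fin -(ler_pM2l x0) mulr_sumr.
  apply: le_trans (_ : moment D F (2 * x) <= _).
    by apply: ler_sum => e _; apply: arc_mass_moment; exact: ltW.
  by apply: (le_trans (momentP uF _)); nra.
rewrite ge0_fin_numE; first exact: le_lt_trans xrho (ltry _).
by apply: esum_ge0 => e _; exact: measure_ge0.
Qed.

(** Finitely many arcs carry almost all of the length at depth less than [x0];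
what the other arcs carry at smaller depths is even less. *)
Lemma below_approx (x0 eps : R) : 0 < x0 -> 0 < eps ->
  exists2 F : seq (garc T), uniq F &
    forall x, x <= x0 -> (lambda (below x) <= (mass D F x + eps)%:E)%E.
Proof.
move=> x00 eps0; have fin0 := lambda_below_fin x00.
have : (lambda (below x0) - eps%:E < lambda (below x0))%E.
  by rewrite -(fineK fin0) -EFinB lte_fin; lra.
rewrite {2}(lambda_below arc_depth) => /ereal_sup_gt[_ [A [finA _] <-]].
rewrite fsbig_finite// sumEFin; set F := finmap.enum_fset _ => HF.
have uF : uniq F by exact: finmap.fset_uniq.
exists F => // x xx0; rewrite (lambda_below arc_depth); apply: esum_le_sum => r ur.
rewrite sumEFin lee_fin (bigID (mem F))/=; apply: lerD.
  rewrite -big_filter (perm_big [seq e <- F | e \in r]); last first.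
    apply: uniq_perm; rewrite ?filter_uniq// => e.
    by rewrite !mem_filter andbC.
  rewrite big_filter /mass [leRHS](bigID (mem r))/= lerDl.
  by apply: sumr_ge0 => e _; exact: arc_mass_ge0.
rewrite -big_filter; set r' := [seq e <- r | e \notin F].
apply: le_trans (_ : mass D r' x0 <= _).
  by apply: ler_sum => e _; exact: arc_mass_le.
have ur' : uniq (r' ++ F).
  rewrite cat_uniq filter_uniq// uF andbT/=; apply/hasPn => e eF.
  by rewrite mem_filter eF.
have : (\sum_(e <- r' ++ F) (arc_mass D e x0)%:E <= lambda (below x0))%E.
  by rewrite (lambda_below arc_depth); exact: sum_le_esum.
rewrite sumEFin big_cat/= -/(mass D r' x0) -/(mass D F x0).
move: HF; rewrite -/(mass D F x0) -(fineK fin0) -EFinB lte_fin lee_fin /=; lra.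
Qed.

End Balls.

(** * The random draws *)

Section Draws.
Variables (R : realType) (d : measure_display) (Omega : measurableType d).
Variables (P : probability Omega R) (X : int -> Omega -> R) (c : int -> Omega -> bool).
Hypothesis draws : doubling_draws P X c.
Variable j : int.
Local Open Scope ereal_scope.
Local Notation U := (uniform_prob (pow2_lt R j)).
Local Notation U' := (uniform_prob (pow2_lt R (j + 1))).

(* [uniform_prob] lives on this copy of the Borel structure of [R]. *)
Local Notation RR := (measurableTypeR R * measurableTypeR R)%type.

Definition draw_pair (w : Omega) : RR := (X j w, X (j + 1) w).

Lemma measurable_draw_pair : measurable_fun setT draw_pair.
Proof.
by apply: measurable_fun_pair; exact: (draw_measurable draws).
Qed.

Lemma measurable_coin B : measurable [set w | c j w = B].
Proof.
have := coin_measurable draws j measurableT (Y := [set B]).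
by rewrite setTI; apply.
Qed.

Lemma coin_half B : P [set w | c j w = B] = (2^-1)%:E.
Proof.
case: B; first exact: (coin_fair draws).
rewrite (_ : [set w | c j w = false] = ~` [set w | c j w]); last first.
  by apply/seteqP; split => w /=; case: (c j w).
rewrite probability_setC; last exact: (measurable_coin true).
rewrite (coin_fair draws) -EFinB; congr EFin; lra.
Qed.

(** Independence speaks of rectangles only; the uniqueness of the product
measure extends it to all Borel sets of pairs. *)
Lemma draw_pair_law B (E : set RR) : measurable E ->
  P ([set w | c j w = B] `&` draw_pair @^-1` E) = (2^-1)%:E * (U \x U') E.
Proof.
move=> mE; have mC := measurable_coin B; have mf := measurable_draw_pair.
pose two := NngNum (ler0n R 2).
have [nu nuE] : exists nu : {measure set RR -> \bar R}, forall A,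
    nu A = 2%R%:E * P (draw_pair @^-1` A `&` [set w | c j w = B]).
  by unshelve (eexists (mscale two (pushforward (mrestr P mC) draw_pair))).
have -> : (U \x U') E = nu E.
  apply: (product_measure_unique (m' := nu)) => // A A' mA mA'; rewrite nuE.
  pose G (i : int + int) : set Omega := match i with
    | inl k => if k == j then X j @^-1` A else X (j + 1)%R @^-1` A'
    | inr _ => [set w | c j w = B] end.
  have j1 : (j + 1 == j)%R = false by rewrite -subr_eq0 addrAC subrr.
  have := draw_indep draws (s := [:: inl j; inl (j + 1)%R; inr j]) (A := G).
  rewrite !big_cons big_nil mule1 /= eqxx j1 => indep.
  have -> : draw_pair @^-1` (A `*` A') `&` [set w | c j w = B] =
      \bigcap_(i in [set` [:: inl j; inl (j + 1)%R; inr j]]) G i.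
    apply/seteqP; split => w /=.
      move=> [[/= wA wA'] wB] i /=; rewrite ?inE => /or3P[] /eqP->; rewrite /G ?eqxx ?j1//.
    move=> wG; have := wG (inl j); have := wG (inl (j + 1)%R); have := wG (inr j).
    rewrite /= ?inE /G !eqxx j1 ?orbT/= => h1 h2 h3.
    by split; [split; [exact: h3|exact: h2]|exact: h1].
  rewrite indep; last 2 first.
  - rewrite /= !inE !andbT; apply/negP => /orP[|//] /eqP[] /esym/eqP.
    by rewrite j1.
  - move=> i; rewrite ?inE => /or3P[] /eqP->; rewrite /G /= ?eqxx ?j1.
    + by exists A.
    + by exists A'.
    + by exists [set B].
  rewrite (draw_uniform draws)// (draw_uniform draws)// coin_half.
  rewrite [X in 2%R%:E * X]muleA [X in 2%R%:E * X]muleC.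
  have two_half : 2%R%:E * (2^-1)%R%:E = 1 :> \bar R by rewrite -EFinM mulfV.
  by rewrite !muleA two_half mul1e.
rewrite nuE muleA -EFinM mulVf// mul1e.
by rewrite setIC.
Qed.

Lemma measurable_draws (g : bool -> RR -> \bar R) :
  (forall B, measurable_fun setT (g B)) ->
  measurable_fun setT (fun w => g (c j w) (draw_pair w)).
Proof.
move=> mg; have mgX B : measurable_fun setT (g B \o draw_pair).
  exact: measurableT_comp (mg B) measurable_draw_pair.
rewrite (_ : (fun w => _) = (fun w => if c j w then g true (draw_pair w)
  else g false (draw_pair w))); last by apply/funext => w; case: (c j w).
by apply: measurable_fun_ifT; [exact: (coin_measurable draws)|exact: mgX|exact: mgX].
Qed.

Lemma expectation_coin (g : bool -> RR -> \bar R) :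
  (forall B, measurable_fun setT (g B)) -> (forall B z, 0 <= g B z) ->
  \int[P]_w g (c j w) (draw_pair w) =
  (2^-1)%:E * \int[U \x U']_z (g true z + g false z).
Proof.
move=> mg g0; have mf := measurable_draw_pair.
have mgX B : measurable_fun setT (g B \o draw_pair).
  exact: measurableT_comp (mg B) mf.
have half0 : (0 <= 2^-1 :> R)%R by rewrite invr_ge0.
pose half := NngNum half0.
have side B : \int[P]_(w in [set w | c j w = B]) g B (draw_pair w) =
    (2^-1)%:E * \int[U \x U']_z g B z.
  have mC := measurable_coin B.
  transitivity (\int[mrestr P mC]_w g B (draw_pair w)).
    rewrite -(setUv [set w | c j w = B]).
    rewrite (ge0_integral_setU _ mC (measurableC mC)); last 3 first.
    - by rewrite setUv; exact: mgX.
    - by move=> w _; exact: g0.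
    - by rewrite disj_set2E setICr.
    rewrite [X in _ + X](_ : _ = 0) ?adde0.
      by apply: eq_measure_integral => A mA AC; rewrite /mrestr; congr (P _);
        apply/esym/setIidl.
    rewrite (eq_measure_integral mzero) ?integral_measure_zero// => A mA AC.
    rewrite /= /mrestr (_ : A `&` _ = set0) ?measure0//.
    by apply/seteqP; split => // w [/AC].
  transitivity (\int[pushforward (mrestr P mC) draw_pair]_z g B z).
    by rewrite ge0_integral_pushforward// => z _; exact: g0.
  transitivity (\int[mscale half (U \x U')]_z g B z).
    apply: eq_measure_integral => E mE _.
    have := draw_pair_law B mE; rewrite setIC => PE.
    by rewrite /= /mscale/= -PE.
  by rewrite ge0_integral_mscale.
rewrite ge0_integralD// ge0_muleDr; last 2 first.
- by apply: integral_ge0 => z _; exact: g0.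
- by apply: integral_ge0 => z _; exact: g0.
have mC := measurable_coin true.
rewrite -!side -(setUv [set w | c j w = true]).
rewrite (ge0_integral_setU _ mC (measurableC mC)); last 3 first.
- by rewrite setUv; exact: measurable_draws.
- by move=> w _; exact: g0.
- by rewrite disj_set2E setICr.
congr (_ + _).
  by apply: eq_integral => w; rewrite inE/= => ->.
rewrite (_ : ~` _ = [set w | c j w = false]); last first.
  by apply/seteqP; split => w /=; case: (c j w).
by apply: eq_integral => w; rewrite inE/= => ->.
Qed.

End Draws.

(** ** Integrals over pairs of thresholds *)

Section IntegralTools.
Variables (d : measure_display) (Omega : measurableType d) (R : realType).
Local Open Scope ereal_scope.

(** The search times of the doubling strategy are only bounded by measurable
functions of the draws, so that [f] must be allowed not to be measurable. *)
Lemma le_integral_nonneg (mu : {measure set Omega -> \bar R}) (f g : Omega -> \bar R) :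
  (forall w, 0 <= f w) -> (forall w, f w <= g w) ->
  \int[mu]_w f w <= \int[mu]_w g w.
Proof.
move=> f0 fg; have g0 w : 0 <= g w by exact: le_trans (fg w).
rewrite !ge0_integralTE//; apply: le_ereal_sup => _ [h hf <-].
by exists h => // w; exact: le_trans (fg w).
Qed.

End IntegralTools.

Section Rectangle.
Variables (R : realType) (M m : R -> R) (C : R) (j : int).
Hypothesis est : forall x y, `|M y - M x - (y - x) * m x| <= C * (y - x) ^+ 2.
Hypothesis m0 : forall x, 0 <= m x.
Local Notation U := (uniform_prob (pow2_lt R j)).
Local Notation U' := (uniform_prob (pow2_lt R (j + 1))).
Local Notation RR := (measurableTypeR R * measurableTypeR R)%type.

Definition rectangle (a1 a2 b1 b2 : R) : set RR :=
  `[a1, a2]%classic `*` `[b1, b2]%classic.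

Lemma measurable_rectangle a1 a2 b1 b2 : measurable (rectangle a1 a2 b1 b2).
Proof. by apply: measurableX; exact: measurable_itv. Qed.

Lemma rectangle_integral (K a1 a2 b1 b2 : R) : 0 <= K ->
  2 ^ (j - 1) <= a1 -> a1 <= a2 -> a2 <= 2 ^ j ->
  2 ^ (j + 1 - 1) <= b1 -> b1 <= b2 -> b2 <= 2 ^ (j + 1) ->
  (\int[U \x U']_z ((fun z : RR => (m z.1 + m z.2 + K)%:E) \_ (rectangle a1 a2 b1 b2)) z
  = (((M a2 - M a1) * (b2 - b1) + (a2 - a1) * (M b2 - M b1)
      + K * (a2 - a1) * (b2 - b1))
     / (2 ^ j - 2 ^ (j - 1)) / (2 ^ (j + 1) - 2 ^ (j + 1 - 1)))%:E)%E.
Proof.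
move=> K0 a1l a12 a2u b1l b12 b2u.
have cm := estimate_continuous est.
have mm : measurable_fun setT (m : measurableTypeR R -> R).
  exact: continuous_measurable_fun.
have mh : measurable_fun setT ((fun z : RR => (m z.1 + m z.2 + K)%:E) \_
    (rectangle a1 a2 b1 b2)).
  apply: (measurable_restrictT _ (measurable_rectangle a1 a2 b1 b2)).1.
  apply: measurable_funTS; apply/measurable_EFinP; apply: measurable_funD => //.
  by apply: measurable_funD; apply: (measurableT_comp mm).
rewrite fubini_tonelli1//; last first.
  by apply: erestrict_ge0 => z _; rewrite lee_fin !addr_ge0.
set q := 2 ^ (j + 1) - 2 ^ (j + 1 - 1); set q0 := 2 ^ j - _.
pose k a := ((m a + K) * (b2 - b1) + (M b2 - M b1)) / q.
have q_gt0 : 0 < q by rewrite subr_gt0 pow2_lt.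
have inner a : fubini_F U' ((fun z : RR => (m z.1 + m z.2 + K)%:E) \_
    (rectangle a1 a2 b1 b2)) a = ((EFin \o k) \_ `[a1, a2]) a.
  rewrite /fubini_F patchE; case: ifPn => aA.
    have estb x y : `|(M y + (m a + K) * y) - (M x + (m a + K) * x)
        - (y - x) * (m a + m x + K)| <= C * (y - x) ^+ 2.
      rewrite (_ : _ - _ - _ = M y - M x - (y - x) * m x) ?est//; ring.
    transitivity (\int[U']_b ((EFin \o (fun b => m a + m b + K)%R) \_ `[b1, b2]) b)%E.
      apply: eq_integral => b _; rewrite !patchE in_setX aA/=.
      by case: ifP.
    rewrite (uniform_integral (K := fun x => M x + (m a + K) * x)
      (k := fun x => m a + m x + K) estb)//; last by move=> x; rewrite !addr_ge0.
    by congr EFin; rewrite /k /q; congr (_ / _); ring.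
  rewrite integral0_eq// => b _; by rewrite patchE in_setX /= (negbTE aA).
under eq_integral do rewrite inner.
have esta x y : `|(M y * (b2 - b1) / q + (K * (b2 - b1) + (M b2 - M b1)) / q * y)
     - (M x * (b2 - b1) / q + (K * (b2 - b1) + (M b2 - M b1)) / q * x)
     - (y - x) * k x| <= C * (b2 - b1) / q * (y - x) ^+ 2.
  rewrite (_ : _ - _ - _ = (M y - M x - (y - x) * m x) * ((b2 - b1) / q)); last first.
    by rewrite /k; field; rewrite gt_eqF.
  have bq : 0 <= (b2 - b1) / q by apply: divr_ge0; [rewrite subr_ge0|exact: ltW].
  rewrite normrM (ger0_norm bq) -[C * _ / q]mulrA mulrAC.
  exact: ler_wpM2r.
rewrite (uniform_integral (K := fun x => M x * (b2 - b1) / q +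
    (K * (b2 - b1) + (M b2 - M b1)) / q * x) (k := k) esta)//; last first.
  move=> x; apply: divr_ge0; last exact: ltW.
  apply: addr_ge0.
    by apply: mulr_ge0; [exact: addr_ge0|rewrite subr_ge0].
  have := estimate_integral est b12 => intE.
  rewrite -lee_fin -intE; apply: integral_ge0 => t _; exact: m0.
congr EFin; rewrite -/q0; have q00 : q0 != 0 by rewrite gt_eqF// subr_gt0 pow2_lt.
by field; rewrite gt_eqF.
Qed.

End Rectangle.

(** * The doubling strategy *)

Lemma dyadic_scale (R : realType) (x : R) : 0 < x ->
  exists i : int, (2 : R) ^ i <= x < 2 ^ (i + 1).
Proof.
move=> x0; have l2 : 0 < ln 2 :> R by rewrite ln_gt0// ltr1n.
pose t := ln x / ln 2.
have tE : 2 `^ t = x :> R.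
  by rewrite /powR pnatr_eq0/= /t divfK ?gt_eqF// lnK// posrE.
exists (Num.floor t); rewrite -!powR_intmul// -{1 2}tE.
have /andP[h1 h2] := Num.Theory.floor_itv t.
apply/andP; split; first by apply: ler_powR => //; rewrite ler1n.
by rewrite /powR pnatr_eq0/= ltr_expR ltr_pM2r.
Qed.

(** ** The search time of a point *)

Section Doubling.
Variables (R : realType) (Q T : metric_graph R) (proj : gpoint T -> gpoint Q).
Variables (D : garc T -> R) (o : garc T -> bool).
Hypothesis arc_depth : outward_depth D o.
Hypothesis spt : shortest_path_tree proj.
Variable rho0 : R.
Hypothesis momentP : forall (F : seq (garc T)) x, uniq F -> 0 < x ->
  moment D F x <= rho0 * x ^+ 2 / 2.

Variables (L : R -> R -> gpoint T -> gpoint T -> Prop).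
Hypothesis dfsL : dfs_rule L.
Variables (d : measure_display) (Omega : measurableType d) (P : probability Omega R).
Variables (X : int -> Omega -> R) (c : int -> Omega -> bool).
Hypothesis draws : doubling_draws P X c.
Variable S : Omega -> R -> set (gpoint Q).
Hypothesis SE : forall w t, S w t = doubling_search proj L (X ^~ w) (c ^~ w) t.

Variable y : gpoint T.
Hypothesis y_gt0 : 0 < depth y.
Local Notation dy := (depth y).
Local Notation RR := (measurableTypeR R * measurableTypeR R)%type.
Local Notation below := (@below R T).
Local Notation cT := (spt_tree spt).1.

Lemma draw_gt0 j w : 0 < X j w.
Proof.
have /andP[h _] := draw_range draws j w; apply: lt_le_trans h.
by rewrite exprz_gt0.
Qed.

Definition visit (B : bool) (z : RR) : \bar R :=
  visit_time (stratum z.1 z.2)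
    (if B then L z.1 z.2 else dfs_rev (L z.1 z.2)) y.

Lemma visit_le B z : (visit B z <= lambda (stratum z.1 z.2 : set (gpoint T)))%E.
Proof. by apply: le_lambda => u []. Qed.

Lemma lambda_stratum_fin a b : 0 < a -> a < b ->
  lambda (stratum a b : set (gpoint T)) \is a fin_num.
Proof.
move=> a0 ab; have b0 := lt_trans a0 ab.
have := lambda_below_fin arc_depth momentP b0.
rewrite -(lambda_belowD arc_depth (ltW ab)) fin_numD => /andP[_].
exact.
Qed.

Lemma search_time_le w j : stratum (X j w) (X (j + 1) w) y ->
  (search_time (S w) (proj y) <=
   lambda (below (X j w)) + visit (c j w) (draw_pair X j w))%E.
Proof.
move=> Wy; have X0 := draw_gt0 j w.
have XX : X j w < X (j + 1) w by case/andP: Wy; exact: le_lt_trans.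
set tau := (X in (_ <= X)%E).
have tauX : (tau <= lambda (below (X (j + 1) w)))%E.
  by rewrite -(lambda_belowD arc_depth (ltW XX)); apply: leeD => //; exact: visit_le.
have tau0 : (0 <= tau)%E.
  by apply: adde_ge0; apply: esum_ge0 => e _; exact: measure_ge0.
have tau_fin : tau \is a fin_num.
  rewrite ge0_fin_numE//; apply: (le_lt_trans tauX).
  rewrite -ge0_fin_numE; last exact: le_trans tauX.
  exact (lambda_below_fin arc_depth momentP (lt_trans X0 XX)).
apply: ereal_inf_lbound; exists (fine tau); last by rewrite fineK.
split.
- by rewrite fine_ge0.
- rewrite fineK//; apply: (le_trans tauX).
  exact (lambda_le_total_length arc_depth spt _).
- by rewrite SE; right; exists j, y; split => //; rewrite fineK.
Qed.

Variables (F : seq (garc T)) (eps : R).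
Hypothesis uF : uniq F.
Hypothesis eps_gt0 : 0 < eps.
Local Notation m := (mass D F).
Local Notation M := (moment D F).

(** Bounds on the search time of [y] for the two outcomes of the coin, arranged
so that their sum does not depend on the depth-first search. *)
Definition coin_bound (B : bool) (z : RR) : \bar R :=
  if B then ((m z.1 + eps)%:E + visit true z)%E
  else ((m z.2 + eps + dy)%:E - visit true z)%E.

Definition straddling : set RR := [set z : RR | 0 < z.1 /\ stratum z.1 z.2 y].

Lemma measurable_straddling : measurable straddling.
Proof.
rewrite (_ : straddling = `]0, dy]%classic `*` `]dy, +oo[%classic).
  by apply: measurableX; exact: measurable_itv.
apply/seteqP; split => -[a b] /=.
  by move=> [a0 /andP[/= ay yb]]; rewrite !in_itv/= a0 ay yb.
rewrite !in_itv/= andbT => -[/andP[a0 ay] yb]; split => //.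
by rewrite /stratum /= ay.
Qed.

Section Scale.
Variables (xmax : R).
Hypothesis approx : forall x, x <= xmax ->
  (lambda (below x) <= (m x + eps)%:E)%E.

Lemma visit_fin z : straddling z -> visit true z \is a fin_num.
Proof.
move=> [z0 /andP[h1 h2]].
have := lambda_stratum_fin z0 (le_lt_trans h1 h2).
have v0 : (0 <= visit true z)%E by apply: esum_ge0 => e _; exact: measure_ge0.
rewrite !ge0_fin_numE//; last by apply: esum_ge0 => e _; exact: measure_ge0.
by apply: le_lt_trans; exact: visit_le.
Qed.

Lemma coin_bound_ge0 B z : straddling z -> z.2 <= xmax -> (0 <= coin_bound B z)%E.
Proof.
move=> iz zx; rewrite /coin_bound; case: B.
  apply: adde_ge0; first by rewrite lee_fin addr_ge0 ?mass_ge0// ltW.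
  by apply: esum_ge0 => e _; exact: measure_ge0.
rewrite sube_ge0 ?visit_fin//; apply: (le_trans (visit_le _ _)).
have [z0 /andP[h1 h2]] := iz; have z12 := le_lt_trans h1 h2.
apply: (@le_trans _ _ (lambda (below z.2))).
  rewrite -(lambda_belowD arc_depth (ltW z12)) leeDr//.
  by apply: esum_ge0 => e _; exact: measure_ge0.
by apply: (le_trans (approx zx)); rewrite lee_fin lerDl ltW.
Qed.

Lemma search_time_coin_bound w j : straddling (draw_pair X j w) ->
  X (j + 1) w <= xmax ->
  (search_time (S w) (proj y) <= coin_bound (c j w) (draw_pair X j w))%E.
Proof.
set z := draw_pair X j w => iz zx; have [z0 Wy] := iz.
have /andP[zy yz] := Wy; have z12 : X j w < X (j + 1) w by exact: le_lt_trans yz.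
apply: (le_trans (search_time_le Wy)); rewrite -/z /coin_bound.
case: (c j w).
  by apply: leeD => //; apply: approx; exact: ltW (lt_le_trans z12 zx).
rewrite leeBrDr ?visit_fin// -addeA.
have dfsj := dfsL.1 _ _ z0 z12.
apply: (@le_trans _ _ (lambda (below (X j w)) +
   (lambda (stratum (X j w) (X (j + 1) w) : set (gpoint T)) + (dy - X j w)%:E))%E).
  apply: leeD => //; rewrite addeC.
  exact (visit_time_rev arc_depth cT dfsj Wy).
rewrite addeA (lambda_belowD arc_depth (ltW z12)) [leRHS]EFinD.
apply: leeD; first exact: approx.
by rewrite lee_fin gerBl ltW// draw_gt0.
Qed.

End Scale.

Lemma measurable_coin_bound B : measurable_fun straddling (coin_bound B).
Proof.
have mv : measurable_fun straddling (visit true) by exact: dfsL.2.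
have cm := estimate_continuous (moment_estimate D F).
have mm : measurable_fun setT (m : measurableTypeR R -> R).
  exact: continuous_measurable_fun.
have m1 : measurable_fun straddling (fun z : RR => (m z.1 + eps)%:E).
  apply: measurable_funTS; apply/measurable_EFinP; apply: measurable_funD => //.
  exact: (measurableT_comp mm).
have m2 : measurable_fun straddling (fun z : RR => (m z.2 + eps + dy)%:E).
  apply: measurable_funTS; apply/measurable_EFinP; apply: measurable_funD => //.
  apply: measurable_funD => //.
  exact: (measurableT_comp mm).
rewrite /coin_bound; case: B; first exact: emeasurable_funD.
by apply: emeasurable_funB.
Qed.

Definition scale_bound (a1 a2 b1 b2 : R) (B : bool) : RR -> \bar R :=
  coin_bound B \_ (rectangle a1 a2 b1 b2 `&` straddling).

(** The depth-first search disappears in the expectation over the coin, and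
there remains an integral over a rectangle of thresholds. *)
Lemma scale_bound_expectation j (a1 a2 b1 b2 xmax : R) :
  (forall x, x <= xmax -> (lambda (below x) <= (m x + eps)%:E)%E) ->
  b2 <= xmax ->
  2 ^ (j - 1) <= a1 -> a1 <= a2 -> a2 <= 2 ^ j ->
  2 ^ (j + 1 - 1) <= b1 -> b1 <= b2 -> b2 <= 2 ^ (j + 1) ->
  [/\ forall B, measurable_fun setT (scale_bound a1 a2 b1 b2 B),
    forall B z, (0 <= scale_bound a1 a2 b1 b2 B z)%E &
  (\int[P]_w scale_bound a1 a2 b1 b2 (c j w) (draw_pair X j w) <=
  (((M a2 - M a1) * (b2 - b1) + (a2 - a1) * (M b2 - M b1)
      + (2 * eps + dy) * (a2 - a1) * (b2 - b1))
     / (2 ^ j - 2 ^ (j - 1)) / (2 ^ (j + 1) - 2 ^ (j + 1 - 1)) / 2)%:E)%E].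
Proof.
move=> approx b2x a1l a12 a2u b1l b12 b2u.
have mR : measurable (rectangle a1 a2 b1 b2 `&` straddling).
  by apply: measurableI; [exact: measurable_rectangle|exact: measurable_straddling].
have mg B : measurable_fun setT (scale_bound a1 a2 b1 b2 B).
  apply: (measurable_restrictT _ mR).1.
  apply: measurable_funS (measurable_coin_bound B); first exact: measurable_straddling.
  exact: subIsetr.
have g0 B z : (0 <= scale_bound a1 a2 b1 b2 B z)%E.
  rewrite /scale_bound; apply: erestrict_ge0 => u [[_ /=]].
  rewrite in_itv/= => /andP[_ ub] iu; apply: (coin_bound_ge0 approx) => //.
  exact: le_trans b2x.
split => //; rewrite (expectation_coin draws)//.
have K0 : 0 <= 2 * eps + dy by rewrite addr_ge0 ?ltW// mulr_gt0.
have := rectangle_integral (moment_estimate D F) (mass_ge0 D F) K0 a1l a12 a2u b1l b12 b2u.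
set r := (X in _ = X%:E) => rE.
rewrite [in leRHS]mulrC EFinM; apply: lee_wpmul2l => //.
rewrite -rE; apply: le_integral_nonneg => z; first exact: adde_ge0.
rewrite /scale_bound !patchE in_setI; case: ifPn => /= [/andP[zR zI]|].
  rewrite zR /coin_bound addeACA subee; last by apply: visit_fin; rewrite inE in zI.
  by rewrite adde0 -EFinD lee_fin; lra.
move=> _; apply: (@le_trans _ _ 0%E); first by rewrite adde0.
case: ifP => _ //; rewrite lee_fin; apply: addr_ge0 => //.
by apply: addr_ge0; exact: mass_ge0.
Qed.

Section Bound.
Variable i : int.
Hypothesis y_scale : 2 ^ i <= dy < 2 ^ (i + 1).
Hypothesis approx : forall x, x <= 2 ^ (i + 1 + 1) ->
  (lambda (below x) <= (m x + eps)%:E)%E.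

(** The contributions of the two iterations that can visit [y]. *)
Definition early := scale_bound (2 ^ (i - 1)) (2 ^ i) dy (2 ^ (i + 1)).
Definition late :=
  scale_bound (2 ^ (i + 1 - 1)) dy (2 ^ (i + 1 + 1 - 1)) (2 ^ (i + 1 + 1)).

(** The stratum of [y] starts at the threshold drawn at its own scale or at the
previous one, according to whether the former is at most the depth of [y]. *)
Lemma search_time_early_late w :
  (search_time (S w) (proj y) <= early (c i w) (draw_pair X i w) +
     late (c (i + 1)%R w) (draw_pair X (i + 1) w))%E.
Proof.
have /andP[iy yi] := y_scale.
have e0 B z : (0 <= early B z)%E.
  apply: erestrict_ge0 => u [[_ /=]]; rewrite in_itv/= => /andP[_ ub] iu.
  apply: (coin_bound_ge0 approx) => //; apply: (le_trans ub).
  by rewrite ler_weXz2l ?ler1n// lerDl.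
have l0 B z : (0 <= late B z)%E.
  apply: erestrict_ge0 => u [[_ /=]]; rewrite in_itv/= => /andP[_ ub] iu.
  exact: (coin_bound_ge0 approx).
have /andP[r1 r2] := draw_range draws i w.
have /andP[r3 r4] := draw_range draws (i + 1) w.
have /andP[r5 r6] := draw_range draws (i + 1 + 1) w.
have [Xy|yX] := leP (X (i + 1) w) dy.
  have yX : dy < X (i + 1 + 1) w by apply: (lt_le_trans yi); rewrite addrK in r5.
  have iz : straddling (draw_pair X (i + 1) w).
    by split; [exact: draw_gt0|rewrite /stratum/= Xy].
  apply: (le_trans (search_time_coin_bound approx iz r6)).
  rewrite /late /scale_bound patchE ifT ?leeDr//.
  rewrite inE; split => //; split; rewrite /= in_itv/=; first by rewrite r3.
  by rewrite r5.
have iz : straddling (draw_pair X i w).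
  split; [exact: draw_gt0|rewrite /stratum/= yX andbT].
  exact: le_trans iy.
have rx : X (i + 1) w <= 2 ^ (i + 1 + 1).
  by apply: (le_trans r4); rewrite ler_weXz2l ?ler1n// lerDl.
apply: (le_trans (search_time_coin_bound approx iz rx)).
rewrite /early /scale_bound patchE ifT ?leeDl//.
rewrite inE; split => //; split; rewrite /= in_itv/=; first by rewrite r1.
by rewrite ltW.
Qed.

(** With [p = 2 ^ i] and [M x] the integral of the length up to [x], the
expectation is a combination of [M (p / 2)], [M p], [M (2 * p)] and [M (4 * p)],
to which [M x <= rho0 * x ^+ 2 / 2] is applied.  The factor of [rho0] so obtained
is 5/4 at both ends of the range of the depth of [y] and smaller in between. *)
Lemma expected_search_time_scale :
  (\int[P]_w norm_search_time (S w) (proj y) <=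
   (5 / 4 * rho0 + 1 / 2 + eps / dy)%:E)%E.
Proof.
have /andP[iy yi] := y_scale.
have p0 : 0 < 2 ^ i :> R by rewrite exprz_gt0.
have E1 : 2 ^ (i + 1) = 2 * 2 ^ i :> R by rewrite expfzDr// expr1z mulrC.
have E2 : 2 ^ (i + 1 + 1) = 4 * 2 ^ i :> R.
  by rewrite expfzDr// E1 expr1z; ring.
have E3 : 2 ^ (i - 1) = 2 ^ i / 2 :> R by rewrite expfzDr// exprN1.
have x1 : 2 ^ (i + 1) <= 2 ^ (i + 1 + 1) :> R by rewrite E1 E2; lra.
have b1 : 2 ^ (i + 1 - 1) <= dy by rewrite addrK.
have [||||||me e0 eI] := @scale_bound_expectation i (2 ^ (i - 1)) (2 ^ i) dy
  (2 ^ (i + 1)) _ approx x1 => //; [exact: ltW (pow2_lt _ _)|exact: ltW|].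
have [||||||ml l0 lI] := @scale_bound_expectation (i + 1) (2 ^ (i + 1 - 1)) dy
  (2 ^ (i + 1 + 1 - 1)) (2 ^ (i + 1 + 1)) _ approx (lexx _) => //;
  [exact: ltW|exact: ltW (pow2_lt _ _)|].
pose st w := (early (c i w) (draw_pair X i w) +
  late (c (i + 1)%R w) (draw_pair X (i + 1) w))%E.
have dy0 : 0 <= dy^-1 by rewrite invr_ge0 ltW.
have mE := measurable_draws draws i me.
have mL := measurable_draws draws (i + 1) ml.
apply: (@le_trans _ _ (\int[P]_w ((dy^-1)%:E * st w))%E).
  apply: le_integral_nonneg => w; first exact: norm_search_time_ge0.
  rewrite /norm_search_time; case: eqP => [yO|_].
    apply: mule_ge0; first by rewrite lee_fin.
    by apply: adde_ge0; [exact: e0|exact: l0].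
  rewrite muleC -(spt_depth spt).
  by apply: lee_wpmul2l; [rewrite lee_fin|exact: search_time_early_late].
rewrite ge0_integralZl//; last first.
- by move=> w _; apply: adde_ge0; [exact: e0|exact: l0].
- exact: emeasurable_funD.
rewrite (ge0_integralD P measurableT (fun w _ => e0 _ _) mE (fun w _ => l0 _ _) mL).
apply: (le_trans (lee_wpmul2l _ (leeD eI lI))); first by rewrite lee_fin.
rewrite -EFinD -EFinM lee_fin ler_pdivrMl//.
rewrite !addrK E2 E1 E3.
set p := 2 ^ i in p0 iy yi E1 *; rewrite E1 in yi.
move: (M (p / 2)) (moment_ge0 D F (p / 2)) => Mh Mh0.
move: (M dy) => Md.
have := momentP uF p0; have := momentP uF (_ : 0 < 2 * p).
have := momentP uF (_ : 0 < 4 * p).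
move: (M p) (moment_ge0 D F p) => M1 M10.
move: (M (2 * p)) (M (4 * p)) => M2 M4 /(_ (mulr_gt0 _ p0)) M4le /(_ (mulr_gt0 _ p0)) M2le M1le.
have -> : dy * (5 / 4 * rho0 + 1 / 2 + eps / dy) = 5 / 4 * rho0 * dy + (2 * eps + dy) / 2.
  by field; rewrite gt_eqF.
have -> : p - p / 2 = p / 2 by field.
have -> : 2 * p - p = p by ring.
have -> : 4 * p - 2 * p = 2 * p by ring.
set lhs := (X in X <= _).
have -> : lhs = (4 * (M1 - Mh) * (2 * p - dy) + 2 * p * (M2 - M1)
    + (dy - p) * (M4 - M2)) / (4 * p ^+ 2) + (2 * eps + dy) / 2.
  by rewrite /lhs; field; rewrite gt_eqF.
rewrite lerD2r ler_pdivrMr; last by apply: mulr_gt0 => //; exact: exprn_gt0.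
have {}M4le : M4 <= 8 * (rho0 * p ^+ 2) by apply: le_trans (M4le _) _ => //; lra.
have {}M2le : M2 <= 2 * (rho0 * p ^+ 2) by apply: le_trans (M2le _) _ => //; lra.
have {}M1le : M1 <= rho0 * p ^+ 2 / 2 by [].
have -> : 5 / 4 * rho0 * dy * (4 * p ^+ 2) = 5 * (rho0 * p ^+ 2) * dy by field.
move: (rho0 * p ^+ 2) M4le M2le M1le => q M4le M2le M1le.
have q0 : 0 <= q by lra.
have h4 : (dy - p) * M4 <= (dy - p) * (8 * q) by apply: ler_wpM2l => //; lra.
have h2 : (3 * p - dy) * M2 <= (3 * p - dy) * (2 * q) by apply: ler_wpM2l => //; lra.
have hh : 0 <= Mh * (2 * p - dy) by apply: mulr_ge0 => //; lra.
(* The coefficient of [M p] changes sign at [dy = 3 / 2 * p]. *)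
have h1 : (6 * p - 4 * dy) * M1 <= q * (5 * dy - (6 * dy - 2 * p)).
  have [dp|pd] := leP (4 * dy) (6 * p).
    apply: (@le_trans _ _ ((6 * p - 4 * dy) * (q / 2))).
      by apply: ler_wpM2l => //; lra.
    have := mulr_ge0 q0 (_ : 0 <= dy - p); nra.
  apply: (@le_trans _ _ 0).
    by apply: mulr_le0_ge0 => //; lra.
  by apply: mulr_ge0 => //; lra.
nra.
Qed.

End Bound.
End Doubling.

Lemma rho_of_ge0 (R : realType) (Q : metric_graph R) (d : measure_display)
    (Omega : measurableType d) (P : probability Omega R)
    (S : Omega -> R -> set (gpoint Q)) : (0 <= rho_of P S)%E.
Proof.
apply: le_trans (ereal_sup_ubound _); last by exists (origin Q).
by apply: integral_ge0 => w _; exact: norm_search_time_ge0.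
Qed.

Lemma doubling_le (R : realType) (Q : metric_graph R)
    (d : measure_display) (Omega : measurableType d) (P : probability Omega R)
    (S : Omega -> R -> set (gpoint Q))
    (d' : measure_display) (Omega' : measurableType d') (P' : probability Omega' R)
    (S' : Omega' -> R -> set (gpoint Q)) :
  connected_graph Q -> randomized_doubling P S -> randomized_search P' S' ->
  (rho_of P S <= (5 / 4)%:E * rho_of P' S' + (1 / 2)%:E)%E.
Proof.
move=> cQ; case=> T [proj] [L] [X] [c] [spt dfsL draws SE] rS'.
have := rho_of_ge0 P' S'; case rhoE : (rho_of P' S') => [rho0||] // rho00; last first.
  by rewrite gt0_muley ?lte_fin ?addye// ?leey//; lra.
rewrite lee_fin in rho00.
have [D [rv arc_depth]] := tree_outward_depth (spt_tree spt).
have momentP (F : seq (garc T)) x : uniq F -> 0 < x ->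
    moment D F x <= rho0 * x ^+ 2 / 2.
  by apply: (moment_bound arc_depth cQ spt rS'); rewrite rhoE.
rewrite -EFinM -EFinD; apply: ge_ereal_sup => _ [H _ <-].
have [y yH] := spt_surj spt H.
have [y0|] := eqVneq (depth y) 0.
  rewrite /exp_norm_search_time integral0_eq ?lee_fin//; first by lra.
  move=> w _; rewrite /norm_search_time; case: ifP => // _.
  by rewrite -yH -(spt_depth spt) y0 invr0 mule0.
move=> yn0; have y_gt0 : 0 < depth y by rewrite lt_neqAle eq_sym yn0 depth_ge0.
apply/lee_addgt0Pr => e e0; rewrite -EFinD.
have [i y_scale] := dyadic_scale y_gt0.
have eps0 : 0 < e * depth y by rewrite mulr_gt0.
have x0 : 0 < 2 ^ (i + 1 + 1) :> R by rewrite exprz_gt0.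
have [F uF approx] := below_approx arc_depth momentP x0 eps0.
have := expected_search_time_scale arc_depth spt momentP dfsL draws SE y_gt0
  uF eps0 y_scale approx.
by rewrite mulfK// /exp_norm_search_time yH.
Qed.

Theorem theorem16 (R : realType) (Q : metric_graph R)
    (d : measure_display) (Omega : measurableType d) (P : probability Omega R)
    (S : Omega -> R -> set (gpoint Q)) :
  network Q -> randomized_doubling P S ->
  (rho_of P S <= (5 / 4)%:E * rho Q + (1 / 2)%:E)%E.
Proof.
move=> [cQ _ _] dS.
have rho_ge0 : (0 <= rho Q)%E.
  apply: le_ereal_inf_tmp => _ [d' [Om [pr [Se [_ ->]]]]].
  exact: rho_of_ge0.
case rhoE : (rho Q) rho_ge0 => [r||] // r0; last first.
  by rewrite gt0_muley ?lte_fin ?addye// ?leey//; lra.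
apply/lee_addgt0Pr => e e0.
have /ereal_inf_lt[_ [d' [Om [pr [Se [rS' ->]]]]] lt_e] :
    (rho Q < (r + e * (4 / 5))%:E)%E.
  by rewrite rhoE lte_fin ltrDl; lra.
apply: (le_trans (doubling_le cQ dS rS')).
apply: (@le_trans _ _ ((5 / 4)%:E * (r + e * (4 / 5))%:E + (1 / 2)%:E)%E).
  by apply: leeD => //; apply: lee_wpmul2l; [rewrite lee_fin; lra|exact: ltW].
by rewrite -!EFinM -!EFinD lee_fin; lra.
Qed.
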